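(* Let $i,j\in\mathbb{N}_0$ and let $\mathbf a=(a_1,\ldots,a_i)\in\mathbb{R}^i$, $\mathbf b=(b_1,\ldots,b_j)\in\mathbb{R}^j$ be such that: (i) $a_s\notin[0,1)$ for all $s\le i$ and $b_s\notin[0,1)$ for all $s\le j$; (ii) the number of negative reals among $a_1,\ldots,a_i,b_1,\ldots,b_j$ is even; (iii) the hypergeometric polynomial $\mathcal{H}^{\mathbf a,\mathbf b}_n$ has only real nonpositive roots for all $n$ large enough. Then the function $$\alpha\mapsto\frac{\alpha}{1-\alpha}\,\frac{\prod_{s=1}^j(b_s-1+\alpha)}{\prod_{s=1}^i(a_s-1+\alpha)}$$ is positive and invertible on $(0,1)$, with inverse denoted by $\Phi^{\mathbf a,\mathbf b}$, and $[\![\mathcal{H}^{\mathbf a,\mathbf b}_n]\!]_n$ converges weakly, as $n\to\infty$, to a distribution with the Cauchy transform $G^{\mathbf a,\mathbf b}(t):=\Phi^{\mathbf a,\mathbf b}(t)/t$, $t>0$.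
   Context: For $y\in\mathbb{R}$ and $r\in\mathbb{N}_0$ let $y^{\underline r}=y(y-1)\cdots(y-r+1)=\Gamma(y+1)/\Gamma(y-r+1)$ be the falling factorial ($y^{\underline 0}=1$; the product form is used whenever the Gamma functions have poles). For a vector $\mathbf c=(c_1,\ldots,c_p)$ put $(\mathbf cn)^{\underline r}:=\prod_{s=1}^p(c_sn)^{\underline r}$ (an empty product is $1$). The (rescaled) hypergeometric polynomial is $$\mathcal{H}^{\mathbf a,\mathbf b}_n(x)=\sum_{k=0}^n\binom nk\,n^{(i-j)(n-k)}\,\frac{(\mathbf bn)^{\underline{n-k}}}{(\mathbf an)^{\underline{n-k}}}\,x^k .$$ For a polynomial $P\not\equiv0$ of degree at most $n$, $[\![P]\!]_n:=\frac1n\sum_{z\in\mathbb{C}:P(z)=0}\delta_z+\frac{n-\deg P}{n}\delta_\infty$ (zeros counted with multiplicity) is the empirical distribution of zeros. When $P$ has only nonpositive zeros, $\infty$ is identified with $-\infty$ and $[\![P]\!]_n$ is a probability measure on $[-\infty,0]$, on which space weak convergence is understood. The Cauchy transform of a probability measure $\mu$ on $[-\infty,0]$ is $G(t)=\int\frac{\mu(\mathrm{d}z)}{t-z}$, $t>0$ (a mass at $-\infty$ contributes $0$). *)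

(* Defs.v *)
From HB Require Import structures.
From mathcomp Require Import all_boot all_order all_algebra.
From mathcomp Require Import complex.
From mathcomp Require Import all_classical all_reals all_analysis.
From mathcomp Require Import measurable_realfun.

Set Implicit Arguments.
Unset Strict Implicit.
Unset Printing Implicit Defensive.

Import Order.TTheory GRing.Theory Num.Theory.
Import numFieldNormedType.Exports.

Local Open Scope classical_set_scope.
Local Open Scope ring_scope.

Definition falling (R : realType) (y : R) (r : nat) : R :=
  \prod_(k < r) (y - k%:R).

(* (c n)^{\underline r} for a vector c = (c_1, ..., c_p) *)
Definition falling_vec (R : realType) (p : nat) (c : 'rV[R]_p) (n r : nat) : R :=
  \prod_(s < p) falling (c ord0 s * n%:R) r.

(* The exponent (i - j)(n - k) is an integer that may be negative. *)
Definition hyp_poly (R : realType) (i j : nat) (a : 'rV[R]_i) (b : 'rV[R]_j)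
    (n : nat) : {poly R} :=
  \poly_(k < n.+1)
    ('C(n, k)%:R * n%:R ^ ((i%:Z - j%:Z) * (n - k)%N%:Z)
     * (falling_vec b n (n - k) / falling_vec a n (n - k))).

Definition to_complex_poly (R : realType) (P : {poly R}) : {poly R[i]} :=
  map_poly (real_complex R) P.

Definition only_real_nonpos_roots (R : realType) (P : {poly R}) : Prop :=
  forall z : R[i], root (to_complex_poly P) z -> complex.Im z = 0 /\ complex.Re z <= 0.

(* The complex zeros of P, repeated according to multiplicity. *)
Definition complex_zeros (R : realType) (P : {poly R}) : seq R[i] :=
  sval (closed_field_poly_normal (to_complex_poly P)).

(* The n zeros of P in the Riemann sphere, None being the point at infinity,
   when P is regarded as a polynomial of degree at most n. *)
Definition sphere_zeros (R : realType) (n : nat) (P : {poly R}) :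
    seq (option R[i]) :=
  map Some (complex_zeros P) ++ nseq (n - (size P).-1) None.

(* Identification of the subset {z real, z <= 0} U {infinity} of the sphere with
   [-oo, 0]; it is only meaningful on that subset. *)
Definition sphere_to_ereal (R : realType) (w : option R[i]) : \bar R :=
  if w is Some z then (complex.Re z)%:E else -oo%E.

(* Used for nonzero P of degree at most n having only real nonpositive roots. *)
Definition empirical_zeros (R : realType) (n : nat) (P : {poly R}) :
    {measure set \bar R -> \bar R} :=
  let zs := sphere_zeros n P in
  mscale (n%:R^-1)%:nng
    (msum (fun k => dirac (sphere_to_ereal (nth None zs k))) (size zs)).

Definition nonpos_ereal (R : realType) : set (\bar R) :=
  [set x | (x <= 0)%E].
Arguments nonpos_ereal R : clear implicits.

(* Since [-oo, 0] is compact, continuous test functions are bounded. *)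
Definition weakly_converges (R : realType)
    (mu_ : nat -> {measure set \bar R -> \bar R})
    (mu : {measure set \bar R -> \bar R}) : Prop :=
  forall f : \bar R -> R, {within nonpos_ereal R, continuous f} ->
    (fun n => \int[mu_ n]_(z in nonpos_ereal R) (f z)%:E)%E @ \oo -->
    (\int[mu]_(z in nonpos_ereal R) (f z)%:E)%E.

Definition cauchy_kernel (R : realType) (t : R) (z : \bar R) : R :=
  if z is r%:E then (t - r)^-1 else 0.

Definition cauchy_transform (R : realType)
    (mu : {measure set \bar R -> \bar R}) (t : R) : \bar R :=
  (\int[mu]_(z in nonpos_ereal R) (cauchy_kernel t z)%:E)%E.

Definition hyp_ratio (R : realType) (i j : nat) (a : 'rV[R]_i) (b : 'rV[R]_j)
    (alpha : R) : R :=
  alpha / (1 - alpha) *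
  ((\prod_(s < j) (b ord0 s - 1 + alpha)) /
   (\prod_(s < i) (a ord0 s - 1 + alpha))).

(* Inverse of the restriction of hyp_ratio to (0, 1); 0 off the image of (0, 1). *)
Definition Phi (R : realType) (i j : nat) (a : 'rV[R]_i) (b : 'rV[R]_j) :
    R -> R :=
  'pinv_(fun=> 0) `]0, 1[ (hyp_ratio a b).

(* Main.v *)
Require Import Defs.
From HB Require Import structures.
From mathcomp Require Import all_boot all_order all_algebra.
From mathcomp Require Import complex.
From mathcomp Require Import all_classical all_reals all_analysis.
From mathcomp Require Import measurable_realfun.
From mathcomp Require Import zify ring lra.

(** Write H_n = sum_k 'C(n, k) q_k x^k.  Consecutive weights q_k ([hyp_weight])
    satisfy q_k = q_(k+1) g((k+1)/n), where
    g(al) = prod_s (b_s - 1 + al) / prod_s (a_s - 1 + al) ([shift_ratio]),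
    and the function of the theorem is r(al) = al / (1 - al) * g(al).

    Monotonicity.  The coefficients of a polynomial with only negative zeros
    satisfy Newton's inequalities in their sharp form: q is positive and
    log-concave ([newton_inequalities], by induction on the zeros).  Hence g is
    positive and nondecreasing along the grid k/n for every large n, and by
    continuity on the whole of ]0, 1] ([shift_ratio_nondecreasing]).  As
    al / (1 - al) increases strictly from 0 to infinity, so does r, and r is a
    bijection of ]0, 1[ onto ]0, +oo[.

    Cauchy transforms.  For t > 0, t H_n'(t) / (n H_n(t)) is the mean of k/n
    when k has weight c_k = 'C(n, k) q_k t^k.  The recursion for q is a detailed
    balance relation between c_k and c_(k+1), and it gives the variance bound
    familiar from Bernstein polynomials: if r(th) = t, the mean of
    (k/n - th)^2 is at most 1/n ([balanced_weights_variance],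
    [log_deriv_concentration]).  Since H_n'/(n H_n) is the Cauchy transform of
    the empirical distribution of zeros, this transform converges at every t > 0
    to Phi(t)/t.

    Weak convergence.  The map z |-> 1/(1 - z) turns [-oo, 0] into [0, 1] and
    the Cauchy kernels into u/(1 + s u).  Convergence of the means of these for
    all s >= 0 forces convergence of all moments ([stieltjes_cvg_moments]), and
    by Weierstrass' theorem of the means of all continuous functions.  The limit
    law is obtained as in Helly's theorem, but on quantile functions: they take
    values in [0, 1], so they converge pointwise along an ultrafilter, and they
    are monotone, so their integrals are controlled uniformly by Riemann sums
    ([riemann_sum_nondecreasing]), which replaces dominated convergence.
    The law of the limiting quantile function on the unit interval is the limit
    distribution ([helly_stieltjes]). *)

Set Implicit Arguments.
Unset Strict Implicit.
Unset Printing Implicit Defensive.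

Import Order.TTheory GRing.Theory Num.Theory.
Import numFieldNormedType.Exports.

Local Open Scope classical_set_scope.
Local Open Scope ring_scope.

(** * Newton's inequalities *)

(** Multiplying sum_k 'C(n, k) q_k X^k by X + c turns q into q' with
    (n + 1) q'_k = (n + 1 - k) c q_k + k q_(k-1).  Log-concavity is preserved: after the cross
    terms are bounded by log-concavity of q, what remains of the new
    inequality at k + 1 is the square (c q_(k+1) - q_k)^2. *)
Lemma newton_inequalities (R : realFieldType) (s : seq R) :
  (forall x, x \in s -> 0 < x) ->
  exists q : nat -> R,
  [/\ forall k, (k <= size s)%N -> 0 < q k,
      forall k, (k.+2 <= size s)%N -> q k * q k.+2 <= q k.+1 ^+ 2 &
      forall k, (\prod_(x <- s) ('X + x%:P))`_k = 'C(size s, k)%:R * q k].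
Proof.
elim: s => [|c s IHs] s_gt0.
  exists (fun=> 1); split => // k; rewrite big_nil mulr1 coef1.
  by case: k => [|k]; rewrite ?bin0 ?bin0n.
have c_gt0 : 0 < c by apply: s_gt0; rewrite mem_head.
have [|q [q_gt0 q_lc q_coef]] := IHs.
  by move=> x xs; apply: s_gt0; rewrite in_cons xs orbT.
set n := size s.
have Sn_gt0 : 0 < n.+1%:R :> R by rewrite ltr0n.
pose q' k : R := ((n.+1 - k)%:R * c * q k + k%:R * q k.-1) / n.+1%:R.
exists q'; split => /=; rewrite -/n.
- move=> k; rewrite leq_eqVlt => /orP[/eqP ->|].
    by rewrite /q' subnn 2!mul0r add0r divr_gt0// mulr_gt0// q_gt0.
  rewrite !ltnS => kn; rewrite /q' divr_gt0// ltr_wpDr//.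
    by rewrite mulr_ge0// ltW// q_gt0// (leq_trans (leq_pred k)).
  by rewrite !mulr_gt0// ?q_gt0// ltr0n subn_gt0 ltnS.
- move=> k; rewrite ltnS => kn.
  rewrite /q' mulrACA -expr2 exprMn ler_pM2r ?exprn_gt0 ?invr_gt0//.
  (* [l] counts the indices above [k + 2], [k] those below: a boundary term is
     missing exactly when its factor [l] or [k] vanishes. *)
  have [l ln] : exists l, n = (l + k.+1)%N.
    by exists (n - k.+1)%N; rewrite subnK.
  have -> : (n.+1 - k)%N = l.+2 by rewrite ln; lia.
  have -> : (n.+1 - k.+1)%N = l.+1 by rewrite ln; lia.
  have -> : (n.+1 - k.+2)%N = l by rewrite ln; lia.
  rewrite /=; set x := q k; set y := q k.+1.
  have x_gt0 : 0 < x by apply: q_gt0; rewrite -/n; lia.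
  have y_gt0 : 0 < y by apply: q_gt0; rewrite -/n; lia.
  have Wy : k%:R * (q k.-1 * y) <= k%:R * x ^+ 2.
    case: k @x @y x_gt0 y_gt0 kn ln => [|k] x y x_gt0 y_gt0 kn ln.
      by rewrite !mul0r.
    by rewrite ler_wpM2l// q_lc.
  have xZ : l%:R * (x * q k.+2) <= l%:R * y ^+ 2.
    case: l ln => [|l] ln; first by rewrite !mul0r.
    by rewrite ler_wpM2l// q_lc// -/n ln; lia.
  have WZ : l%:R * (k%:R * (q k.-1 * q k.+2)) <= l%:R * (k%:R * (x * y)).
    case: k l @x @y x_gt0 y_gt0 kn ln Wy xZ => [|k] [|l] x y x_gt0 y_gt0 kn ln Wy xZ;
      rewrite ?mul0r ?mulr0 //.
    rewrite ler_wpM2l// ler_wpM2l//=.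
    have W_gt0 : 0 < q k by apply: q_gt0; rewrite -/n; lia.
    have Z_gt0 : 0 < q k.+3 by apply: q_gt0; rewrite -/n; lia.
    rewrite /= !ler_pM2l ?ltr0n// in Wy xZ.
    rewrite -(ler_pM2r (mulr_gt0 x_gt0 y_gt0)).
    have := ler_pM (ltW (mulr_gt0 W_gt0 y_gt0)) (ltW (mulr_gt0 x_gt0 Z_gt0)) Wy xZ.
    by congr (_ <= _); ring.
  rewrite -subr_ge0.
  set W := q k.-1 in Wy WZ *; set Z := q k.+2 in xZ WZ *.
  rewrite -!natr1 in Wy xZ WZ *.
  move: Wy xZ WZ; set A : R := k%:R; set L : R := l%:R => Wy xZ WZ.
  have A0 : 0 <= A by rewrite /A.
  have L0 : 0 <= L by rewrite /L.
  (* The difference of the two sides is [h1 + h2 + h3 + h4]. *)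
  have h1 : 0 <= (A + 2) * (A * x ^+ 2 - A * (W * y)).
    by rewrite mulr_ge0 ?subr_ge0//; lra.
  have h2 : 0 <= (L + 2) * c ^+ 2 * (L * y ^+ 2 - L * (x * Z)).
    by rewrite mulr_ge0 ?subr_ge0// mulr_ge0 ?sqr_ge0//; lra.
  have h3 : 0 <= c * (L * (A * (x * y)) - L * (A * (W * Z))).
    by rewrite mulr_ge0 ?subr_ge0// ltW.
  have h4 := sqr_ge0 (c * y - x).
  have := addr_ge0 (addr_ge0 h1 h2) (addr_ge0 h3 h4).
  by congr (0 <= _); ring.
- move=> k; rewrite big_cons mulrDl coefD coefXM coefCM.
  rewrite /q' mulrA; apply: (canRL (mulfK (lt0r_neq0 Sn_gt0))).
  case: k => [|k] /=.
    by rewrite q_coef subn0 !bin0 add0r mul0r addr0; ring.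
  rewrite !q_coef -/n mulrDr mulrDl addrC; congr (_ + _).
    rewrite !mulrA -natrM.
    have -> : ('C(n.+1, k.+1) * (n.+1 - k.+1) = n.+1 * 'C(n, k.+1))%N.
      by rewrite mulnC -mul_bin_left mul_bin_diag.
    by rewrite natrM; ring.
  rewrite !mulrA -natrM [('C(_, _) * _)%N]mulnC -mul_bin_diag natrM; ring.
Qed.

(** * Concentration of weights in detailed balance *)

(** Summing the balance relation against an arbitrary f gives
    sum_k p (n - k) c_k f(k) = sum_k k gam_k c_k f(k - 1).  With f = 1 and
    f(k) = k - n th this says that the drift p (n - k) - k gam_k has mean zero
    and that its mean against k - n th equals minus the mean of p (n - k);
    a drift that pulls towards n th with strength K thus bounds the variance. *)
Lemma balanced_weights_variance (R : realFieldType) (n : nat)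
    (c gam : nat -> R) (p th K : R) :
  0 <= p -> (forall k, (k <= n)%N -> 0 <= c k) ->
  (forall k, (k < n)%N ->
     p * (n%:R - k%:R) * c k = k.+1%:R * gam k.+1 * c k.+1) ->
  (forall k, (k <= n)%N ->
     (p * (n%:R - k%:R) - k%:R * gam k) * (k%:R - n%:R * th)
       <= - K * (k%:R - n%:R * th) ^+ 2) ->
  K * (\sum_(k < n.+1) (k%:R - n%:R * th) ^+ 2 * c k)
    <= p * n%:R * \sum_(k < n.+1) c k.
Proof.
move=> p_ge0 c_ge0 balance drift.
have shift (f : nat -> R) :
    \sum_(k < n.+1) p * (n%:R - k%:R) * c k * f k =
    \sum_(k < n.+1) k%:R * gam k * c k * f k.-1.
  rewrite big_ord_recr/= subrr mulr0 !mul0r addr0.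
  rewrite big_ord_recl/= !mul0r add0r; apply: eq_bigr => k _.
  by rewrite balance.
have drift_mean :
    - (\sum_(k < n.+1) (p * (n%:R - k%:R) - k%:R * gam k) *
         (k%:R - n%:R * th) * c k) =
    \sum_(k < n.+1) p * (n%:R - k%:R) * c k.
  have /eqP := shift (fun k => k%:R - n%:R * th).
  have := shift (fun=> 1).
  under eq_bigr do rewrite mulr1.
  under [X in _ = X -> _]eq_bigr do rewrite mulr1.
  move=> ->; rewrite -subr_eq0 => /eqP sh.
  apply/eqP; rewrite eq_sym -subr_eq0 opprK; apply/eqP.
  rewrite -[RHS]sh -big_split -sumrB/=; apply: eq_bigr => -[[|k] kn] _ /=.
    by ring.
  by rewrite -natr1; ring.
apply: (@le_trans _ _ (\sum_(k < n.+1) p * (n%:R - k%:R) * c k)).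
  rewrite -drift_mean mulr_sumr -sumrN ler_sum// => k _.
  have kn : (k <= n)%N by rewrite -ltnS.
  by rewrite lerNr mulrA -(mulNr _ (c k)) -(mulNr K) ler_wpM2r ?c_ge0 ?drift.
rewrite mulr_sumr ler_sum// => k _.
have kn : (k <= n)%N by rewrite -ltnS.
by rewrite ler_wpM2r ?c_ge0// ler_wpM2l// gerBl.
Qed.

(** Chebyshev's argument in the form needed below: a function that is at most eps
    up to a multiple of the square of the deviation has a small mean. *)
Lemma weighted_sum_concentration (R : realFieldType) (n : nat)
    (c h : nat -> R) (th eps C : R) :
  (0 < n)%N -> 0 <= C -> (forall k, (k <= n)%N -> 0 <= c k) ->
  \sum_(k < n.+1) (k%:R - n%:R * th) ^+ 2 * c k <= n%:R * \sum_(k < n.+1) c k ->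
  (forall k, (k <= n)%N -> `|h k| <= eps + C * (k%:R / n%:R - th) ^+ 2) ->
  `|\sum_(k < n.+1) h k * c k| <= (eps + C / n%:R) * \sum_(k < n.+1) c k.
Proof.
move=> n_gt0 C_ge0 c_ge0 variance h_le.
have n0 : n%:R != 0 :> R by rewrite pnatr_eq0 -lt0n.
apply: (le_trans (ler_norm_sum _ _ _)).
apply: (@le_trans _ _ (\sum_(k < n.+1)
    (eps * c k + C / n%:R ^+ 2 * ((k%:R - n%:R * th) ^+ 2 * c k)))).
  apply: ler_sum => k _; have kn : (k <= n)%N by rewrite -ltnS.
  rewrite normrM (ger0_norm (c_ge0 k kn)).
  apply: le_trans (ler_wpM2r (c_ge0 k kn) (h_le k kn)) _.
  by rewrite le_eqVlt; apply/orP; left; apply/eqP; field.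
rewrite big_split/= -!mulr_sumr mulrDl lerD2l.
apply: le_trans (ler_wpM2l _ variance) _.
  by rewrite divr_ge0// exprn_ge0.
by rewrite le_eqVlt; apply/orP; left; apply/eqP; field.
Qed.

(** * Weierstrass' approximation theorem *)

Definition bernstein_weight (R : realFieldType) (N : nat) (x : R) (k : nat) : R :=
  'C(N, k)%:R * x ^+ k * (1 - x) ^+ (N - k).

(** Bernstein's weights are in balance with constant rates p = x and
    gam = 1 - x; the drift is then exactly n x - k. *)
Lemma bernstein_weights (R : realFieldType) (N : nat) (x : R) :
  0 <= x <= 1 ->
  let c := bernstein_weight N x in
  [/\ forall k, (k <= N)%N -> 0 <= c k, \sum_(k < N.+1) c k = 1 &
      \sum_(k < N.+1) (k%:R - N%:R * x) ^+ 2 * c k <= N%:R].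
Proof.
move=> /andP[x0 x1] c.
have c_ge0 k : (k <= N)%N -> 0 <= c k.
  by rewrite /c /bernstein_weight !mulr_ge0 ?exprn_ge0// subr_ge0.
have sum_c : \sum_(k < N.+1) c k = 1.
  rewrite -[RHS](expr1n _ N) -[1 in RHS](subrK x) exprDn.
  by apply: eq_bigr => k _; rewrite /c /bernstein_weight -mulr_natr; ring.
split => //.
have := @balanced_weights_variance _ N c (fun=> 1 - x) x x 1 x0 c_ge0.
rewrite sum_c mulr1 mul1r => H; apply: le_trans (H _ _) _; last 1 first.
- by rewrite ler_piMl.
- move=> k kN; rewrite /c /bernstein_weight -(subnSK kN) !exprS -natrB ?(ltnW kN)//.
  have := congr1 (fun m => m%:R : R) (mul_bin_left N k).
  rewrite /= !natrM => bin_rec.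
  transitivity ((N - k)%:R * 'C(N, k)%:R *
    (x * x ^+ k * ((1 - x) * (1 - x) ^+ (N - k.+1)))); first by ring.
  by rewrite -bin_rec; ring.
- by move=> k kN; rewrite le_eqVlt; apply/orP; left; apply/eqP; ring.
Qed.

(** The Bernstein polynomial of F at x is the mean of F(k/N) under weights that
    concentrate near k/N = x. *)
Lemma weierstrass_approximation (R : realType) (F : R -> R) :
  (exists M : R, forall x : R, 0 <= x <= 1 -> `|F x| <= M) ->
  (forall eps : R, 0 < eps -> exists2 d : R, 0 < d & forall x y : R, 0 <= x <= 1 ->
     0 <= y <= 1 -> `|x - y| < d -> `|F x - F y| <= eps) ->
  forall eps : R, 0 < eps ->
  exists p : {poly R}, forall x : R, 0 <= x <= 1 -> `|F x - p.[x]| <= eps.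
Proof.
move=> [M F_le] F_uc eps eps_gt0.
have eps2_gt0 : 0 < eps / 2 by rewrite divr_gt0.
have [d d_gt0 F_near] := F_uc _ eps2_gt0.
have M_ge0 : 0 <= M.
  by apply: le_trans (normr_ge0 _) (F_le 0 _); rewrite lexx ler01.
(* On the part where [d <= `|k/N - x|], [C] times the squared deviation
   exceeds the trivial bound [2 * M]. *)
set C := 2 * M / d ^+ 2.
have C_ge0 : 0 <= C by rewrite !mulr_ge0 ?invr_ge0 ?exprn_ge0// ltW.
pose N := (Num.truncn (C / (eps / 2))).+1.
have N_gt0 : (0 < N)%N by [].
have CN : C / N%:R <= eps / 2.
  rewrite ler_pdivrMr ?ltr0n// mulrC -ler_pdivrMr//.
  by apply: ltW; rewrite /N truncnS_gt.
exists (\sum_(k < N.+1) (F (k%:R / N%:R) * 'C(N, k)%:R) *: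
  ('X^k * (1 - 'X) ^+ (N - k))) => x x01.
have [c_ge0 sum_c var_c] := bernstein_weights N x01.
set c := bernstein_weight N x in c_ge0 sum_c var_c.
have -> : F x - (\sum_(k < N.+1) (F (k%:R / N%:R) * 'C(N, k)%:R) *:
    ('X^k * (1 - 'X) ^+ (N - k))).[x] =
    \sum_(k < N.+1) (F x - F (k%:R / N%:R)) * c k.
  under [RHS]eq_bigr do rewrite mulrBl.
  rewrite sumrB -mulr_sumr sum_c mulr1 horner_sum; congr (_ - _).
  apply: eq_bigr => k _; rewrite hornerZ hornerM hornerXn horner_exp hornerD hornerN hornerX hornerC /c /bernstein_weight.
  by rewrite !mulrA.
rewrite -[leRHS]mulr1 -[X in _ <= _ * X]sum_c.
apply: (@le_trans _ _ ((eps / 2 + C / N%:R) * \sum_(k < N.+1) c k)); last first.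
  by rewrite ler_wpM2r ?sum_c//; lra.
apply: (@weighted_sum_concentration _ N c (fun k => F x - F (k%:R / N%:R)) x) => //.
  by rewrite sum_c mulr1.
move=> k kN; set y := k%:R / N%:R.
have y01 : 0 <= y <= 1.
  by rewrite divr_ge0//= ler_pdivrMr ?ltr0n// mul1r ler_nat.
have [xy|xy] := ltP `|x - y| d.
  apply: (le_trans (F_near _ _ x01 y01 xy)).
  by rewrite lerDl mulr_ge0// sqr_ge0.
apply: (@le_trans _ _ (2 * M)).
  by apply: le_trans (ler_normB _ _) _; have := F_le _ x01; have := F_le _ y01; lra.
apply: (@le_trans _ _ (C * (y - x) ^+ 2)); last by rewrite lerDr ltW.
rewrite /C -mulrA ler_peMr ?mulr_ge0//.
rewrite mulrC ler_pdivlMr ?exprn_gt0// mul1r -[leRHS]real_normK ?num_real//.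
by rewrite distrC lerXn2r// nnegrE ?normr_ge0// ltW.
Qed.

(** * Means over finite lists *)

Lemma cvg_uniform_approx (R : realType) (T : Type) (F : set_system T)
    {FF : Filter F} (u : T -> R) (l : R) :
  (forall eps : R, 0 < eps -> exists v : T -> R, exists2 l' : R,
     v @ F --> l' & (\forall n \near F, `|u n - v n| <= eps) /\ `|l - l'| <= eps) ->
  u @ F --> l.
Proof.
move=> approx; apply/cvgrPdist_le => eps eps_gt0.
have eps3_gt0 : 0 < eps / 3 by rewrite divr_gt0.
have [v [l' /cvgrPdist_le/(_ _ eps3_gt0) vl' [uv ll']]] := approx _ eps3_gt0.
apply: filterS2 vl' uv => n vl' uv.
rewrite (_ : l - u n = (l - l') + (l' - v n) - (u n - v n)); last by ring.
apply: le_trans (ler_normB _ _) _; apply: le_trans (lerD (ler_normD _ _) uv) _.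
by rewrite (le_trans (lerD (lerD ll' vl') (lexx _)))//; lra.
Qed.

Lemma is_cvg_uniform_approx (R : realType) (u : nat -> R) :
  (forall eps : R, 0 < eps ->
     exists2 v : nat -> R, cvgn v & forall n, `|u n - v n| <= eps) ->
  cvgn u.
Proof.
move=> approx; apply/cauchy_cvgP/cauchy_exP => eps eps_gt0.
have eps2_gt0 : 0 < eps / 2 by rewrite divr_gt0.
have [v v_cvg uv] := approx _ eps2_gt0.
exists (limn v).
have /cvgrPdist_lt/(_ _ eps2_gt0) := v_cvg.
apply: filterS => n; rewrite /ball/= => vn.
rewrite (_ : limn v - u n = (limn v - v n) - (u n - v n)); last by ring.
by apply: le_lt_trans (ler_normB _ _) _; have := uv n; lra.
Qed.

Definition list_mean (R : realType) (s : seq R) (f : R -> R) : R :=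
  (\sum_(x <- s) f x) / (size s)%:R.

Section list_mean.
Context {R : realType}.
Implicit Types (s : seq R) (f g : R -> R).

Lemma list_meanB s f g :
  list_mean s (fun x => f x - g x) = list_mean s f - list_mean s g.
Proof. by rewrite /list_mean sumrB mulrBl. Qed.

Lemma list_meanZ s (c : R) f : list_mean s (fun x => c * f x) = c * list_mean s f.
Proof. by rewrite /list_mean -mulr_sumr mulrA. Qed.

Lemma eq_in_list_mean s f g :
  {in s, f =1 g} -> list_mean s f = list_mean s g.
Proof. by move=> fg; rewrite /list_mean; congr (_ / _); exact: eq_big_seq. Qed.

Lemma list_mean_horner s (p : {poly R}) :
  list_mean s (horner p) = \sum_(k < size p) p`_k * list_mean s (fun x => x ^+ k).
Proof.
rewrite /list_mean; under eq_bigr do rewrite horner_coef.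
rewrite exchange_big/= mulr_suml; apply: eq_bigr => k _.
by rewrite -mulr_sumr mulrA.
Qed.

Lemma list_mean_bound s f (M : R) :
  0 <= M -> {in s, forall x, `|f x| <= M} -> `|list_mean s f| <= M.
Proof.
move=> M0 fM; rewrite /list_mean normrM normfV [`|_%:R|]ger0_norm//.
have [->|s0] := eqVneq s [::]; first by rewrite big_nil normr0 mul0r.
rewrite ler_pdivrMr ?ltr0n ?lt0n ?size_eq0//.
apply: le_trans (ler_norm_sum _ _ _) _.
apply: (@le_trans _ _ (\sum_(x <- s) M)); last first.
  by rewrite big_const_seq count_predT iter_addr_0 mulr_natr.
by rewrite big_seq_cond [leRHS]big_seq_cond ler_sum// => x /andP[xs _]; exact: fM.
Qed.

End list_mean.

(** Convergence is propagated from the kernels x^(k+1)/(1 + t x) to the next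
    power by x^(k+2)/(1 + t x) = (x^(k+1) - x^(k+1)/(1 + t x))/t, which covers
    t > 0; at t = 0 the kernel is the uniform limit of the previous ones. *)
Lemma stieltjes_cvg_moments (R : realType) (s : nat -> seq R) :
  (forall n x, x \in s n -> 0 <= x <= 1) ->
  (forall t : R, 0 <= t -> cvgn (fun n => list_mean (s n) (fun x => x / (1 + t * x)))) ->
  forall k, cvgn (fun n => list_mean (s n) (fun x => x ^+ k.+1)).
Proof.
move=> s01 stieltjes k.
have den_ge1 (t x : R) : 0 <= t -> 0 <= x -> 1 <= 1 + t * x.
  by move=> t0 x0; rewrite lerDl mulr_ge0.
suff : forall t : R, 0 <= t ->
    cvgn (fun n => list_mean (s n) (fun x => x ^+ k.+1 / (1 + t * x))).
  move=> /(_ 0 (lexx _)).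
  under eq_fun => n do under [list_mean _ _]eq_in_list_mean => x _ do
    rewrite mul0r addr0 divr1.
  by [].
elim: k => // k IHk.
have step (t : R) : 0 < t ->
    cvgn (fun n => list_mean (s n) (fun x => x ^+ k.+2 / (1 + t * x))).
  move=> t_gt0.
  rewrite (_ : (fun n => _) = fun n => t^-1 *
      (list_mean (s n) (fun x => x ^+ k.+1 / (1 + 0 * x)) -
       list_mean (s n) (fun x => x ^+ k.+1 / (1 + t * x)))).
    by apply: is_cvgMr; apply: is_cvgB; apply: IHk => //; exact: ltW.
  apply/funext => n; rewrite -list_meanB -list_meanZ.
  apply: eq_in_list_mean => x /s01/andP[x0 _]; rewrite exprSr.
  by field; rewrite (gt_eqF t_gt0) gt_eqF// (lt_le_trans ltr01)// den_ge1// ltW.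
move=> t; rewrite le_eqVlt => /orP[/eqP <-|]; last exact: step.
apply: is_cvg_uniform_approx => eps eps_gt0.
exists (fun n => list_mean (s n) (fun x => x ^+ k.+2 / (1 + eps * x))).
  exact: step.
move=> n; rewrite -list_meanB; apply: list_mean_bound; first exact: ltW.
move=> x /s01/andP[x0 x1]; rewrite mul0r addr0 divr1.
have den := den_ge1 _ _ (ltW eps_gt0) x0.
have den_gt0 := lt_le_trans ltr01 den.
rewrite (_ : _ - _ = eps * (x ^+ k.+3 / (1 + eps * x))); last first.
  by rewrite [x ^+ k.+3]exprSr; field; rewrite gt_eqF.
rewrite ger0_norm; last first.
  by rewrite mulr_ge0 ?(ltW eps_gt0)// divr_ge0 ?exprn_ge0// ltW.
rewrite ler_piMr ?(ltW eps_gt0)// ler_pdivrMr// mul1r (le_trans _ den)//.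
by rewrite exprn_ile1.
Qed.

(** * Integrals of monotone functions over the unit interval *)

Definition unit_mean (R : realType) (G : R -> R) : R :=
  \int[lebesgue_measure]_(x in `[0, 1]) G x.

Section unit_mean.
Context {R : realType}.
Implicit Types (G : R -> R) (c : nat -> R).

Lemma bounded_unit_integrable G (M : R) :
  measurable_fun `[(0 : R), 1] G -> (forall x, 0 <= x <= 1 -> `|G x| <= M) ->
  lebesgue_measure.-integrable `[0, 1] (EFin \o G).
Proof.
move=> mG GM; apply: measurable_bounded_integrable => //.
  by rewrite /= lebesgue_measure_itv/= lte_fin ltr01 -EFinD ltry.
exists M; split; rewrite ?num_real// => y My x /=.
by rewrite in_itv/= => /GM /le_trans; apply; exact: ltW.
Qed.

Lemma nondecreasing_unit_integrable G :
  nondecreasing_fun G -> lebesgue_measure.-integrable `[0, 1] (EFin \o G).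
Proof.
move=> ndG; apply: (@bounded_unit_integrable G (`|G 0| + `|G 1|)).
  exact: nondecreasing_measurable.
move=> x /andP[x0 x1]; have := ndG _ _ x0; have := ndG _ _ x1.
rewrite ler_norml; have := ler_norm (G 1); have := ler_norm (- G 0).
by rewrite normrN; have := normr_ge0 (G 0); have := normr_ge0 (G 1); lra.
Qed.

Lemma le_unit_mean G1 G2 : nondecreasing_fun G1 -> nondecreasing_fun G2 ->
  (forall x, 0 <= x <= 1 -> G1 x <= G2 x) -> unit_mean G1 <= unit_mean G2.
Proof.
move=> nd1 nd2 G12; apply: le_Rintegral => //.
- exact: nondecreasing_unit_integrable.
- exact: nondecreasing_unit_integrable.
Qed.

Lemma nondecreasing_step c (N : nat) : {homo c : m n / (m <= n)%N >-> m <= n} ->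
  nondecreasing_fun (fun x : R => c (Num.truncn (N%:R * x))).
Proof.
by move=> ndc x y xy; apply: ndc; apply: le_truncn; rewrite ler_wpM2l.
Qed.

(** Only nondecreasing step functions are considered, so that measurability is
    automatic. *)
Lemma unit_mean_step c (N : nat) : (0 < N)%N ->
  {homo c : m n / (m <= n)%N >-> m <= n} ->
  unit_mean (fun x : R => c (Num.truncn (N%:R * x))) = (\sum_(k < N) c k) / N%:R.
Proof.
move=> N_gt0 ndc; have N0 : 0 < N%:R :> R by rewrite ltr0n.
set G := fun x => _.
have iG := nondecreasing_unit_integrable (nondecreasing_step N ndc).
have grid m : (m <= N)%N -> m%:R / N%:R <= 1 :> R.
  by move=> mN; rewrite ler_pdivrMr// mul1r ler_nat.
suff H m : (m <= N)%N ->
    \int[lebesgue_measure]_(x in `[0, m%:R / N%:R[) G x = (\sum_(k < m) c k) / N%:R.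
  rewrite -(H N (leqnn N)) divff ?gt_eqF// Rintegral_itv_bndo_bndc//.
  by apply: integrableS iG => //; apply: subset_itvl; rewrite bnd_simp.
elim: m => [_|m IHm mN].
  by rewrite big_ord0 mul0r set_itvE Rintegral_set0.
have mm : m%:R / N%:R <= m.+1%:R / N%:R :> R by rewrite ler_pM2r ?invr_gt0// ler_nat.
rewrite (@itv_bndbnd_setU _ _ _ (BLeft (m%:R / N%:R))) ?bnd_simp ?divr_ge0//.
rewrite Rintegral_setU//=; last 2 first.
- rewrite -itv_bndbnd_setU ?bnd_simp ?divr_ge0//.
  apply: integrableS iG => // x /=; rewrite !in_itv/= => /andP[-> /ltW x1].
  by rewrite (le_trans x1)// grid.
- apply/disj_setPS => x [] /=; rewrite !in_itv/= => /andP[_ xm] /andP[mx _].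
  by have := lt_le_trans xm mx; rewrite ltxx.
rewrite IHm ?(ltnW mN)// big_ord_recr/= mulrDl; congr (_ + _).
rewrite (@eq_Rintegral _ _ _ _ _ (cst (c m))); last first.
  move=> x; rewrite inE/= in_itv/= => /andP[mx xm]; rewrite /G.
  congr c; apply: truncn_def; rewrite mulrC.
  by rewrite -ler_pdivrMr// mx -ltr_pdivlMr.
rewrite Rintegral_cst//= lebesgue_measure_itv/= lte_fin.
rewrite ltr_pM2r ?invr_gt0// ltr_nat ltnSn/= -mulrBl -natrB// subSnn.
by rewrite mul1r.
Qed.

(** A nondecreasing function lies between the step functions built on its left
    and right grid values, whose integrals differ by a telescoping sum.  The
    bound depends on G only through its range, which is what replaces dominated
    convergence along an ultrafilter. *)
Lemma riemann_sum_nondecreasing G (N : nat) : (0 < N)%N -> nondecreasing_fun G ->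
  `|unit_mean G - (\sum_(k < N) G (k%:R / N%:R)) / N%:R| <= (G 1 - G 0) / N%:R.
Proof.
move=> N_gt0 ndG; have N0 : 0 < N%:R :> R by rewrite ltr0n.
have ndc (d : nat) : {homo (fun k => G ((k + d)%:R / N%:R)) : m n / (m <= n)%N >-> m <= n}.
  by move=> m n mn; apply: ndG; rewrite ler_pM2r ?invr_gt0// ler_nat leq_add2r.
have step_integral d := unit_mean_step N_gt0 (ndc d).
have lower : (\sum_(k < N) G (k%:R / N%:R)) / N%:R <= unit_mean G.
  under eq_bigr do rewrite -[X in X%:R]addn0.
  rewrite -step_integral; apply: le_unit_mean => //.
    exact: (nondecreasing_step N (ndc 0%N)).
  move=> x /andP[x0 x1]; apply: ndG.
  by rewrite addn0 ler_pdivrMr// mulrC truncn_le mulr_ge0.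
have upper : unit_mean G <= (\sum_(k < N) G (k.+1%:R / N%:R)) / N%:R.
  under eq_bigr do rewrite -addn1.
  rewrite -step_integral; apply: le_unit_mean => //.
    exact: (nondecreasing_step N (ndc 1%N)).
  move=> x /andP[x0 x1]; apply: ndG.
  by rewrite addn1 ler_pdivlMr// mulrC ltW// truncnS_gt.
rewrite ger0_norm ?subr_ge0// lerBlDl (le_trans upper)//.
rewrite -mulrDl ler_pM2r ?invr_gt0//.
have shift : G 0 + \sum_(k < N) G (k.+1%:R / N%:R) =
    \sum_(k < N) G (k%:R / N%:R) + G 1.
  transitivity (\sum_(k < N.+1) G (k%:R / N%:R)).
    by rewrite big_ord_recl/= mul0r.
  by rewrite big_ord_recr/= divff// gt_eqF.
by rewrite addrA -shift; lra.
Qed.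

End unit_mean.

(** * Helly's selection theorem for quantile functions *)

(** For a sorted list of numbers in [0, 1] this is the quantile function of the
    uniform law on the list.  The default value 1 keeps it nondecreasing past
    the end of the list. *)
Definition quantile (R : realType) (s : seq R) (u : R) : R :=
  nth 1 s (Num.truncn ((size s)%:R * u)).

Section quantile.
Context {R : realType}.
Implicit Types s : seq R.

Lemma nondecreasing_nth s : sorted <=%R s -> {in s, forall x, x <= 1} ->
  {homo nth 1 s : m n / (m <= n)%N >-> m <= n}.
Proof.
move=> s_sorted s1 m n mn; have [ns|sn] := ltnP n (size s).
  by apply: (sorted_leq_nth le_trans le_refl) => //; rewrite inE// (leq_ltn_trans mn).
rewrite (nth_default _ sn); have [ms|sm] := ltnP m (size s); last by rewrite nth_default.
by rewrite s1// mem_nth.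
Qed.

Lemma nth_unit s n : {in s, forall x, 0 <= x <= 1} -> 0 <= nth 1 s n <= 1.
Proof.
move=> s01; have [ns|sn] := ltnP n (size s); first by rewrite s01// mem_nth.
by rewrite nth_default// ler01 lexx.
Qed.

Lemma list_mean_quantile s (g : R -> R) : s != [::] -> sorted <=%R s ->
  {in s, forall x, 0 <= x <= 1} ->
  {in [pred x : R | 0 <= x <= 1] &, nondecreasing_fun g} ->
  nondecreasing_fun (g \o quantile s) /\ list_mean s g = unit_mean (g \o quantile s).
Proof.
move=> s0 s_sorted s01 ndg.
have nd : {homo (fun k => g (nth 1 s k)) : m n / (m <= n)%N >-> m <= n}.
  move=> m n mn; apply: ndg; rewrite ?inE ?nth_unit//.
  by apply: nondecreasing_nth => // x /s01/andP[].
split; first exact: (nondecreasing_step (size s) nd).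
by rewrite (unit_mean_step _ nd) ?lt0n ?size_eq0// /list_mean (big_nth 1) big_mkord.
Qed.

End quantile.

Lemma ultrafilter_cvg_unit (R : realType) (T : Type) (U : set_system T)
    {UU : UltraFilter U} (f : T -> R) :
  (forall n, 0 <= f n <= 1) -> exists2 l : R, 0 <= l <= 1 & f @ U --> l.
Proof.
move=> f01; have [|l [/= l01 cl]] := @segment_compact R 0 1 (f @ U) _.
  by apply: nearW => n; rewrite /= in_itv/=.
exists l; first by rewrite in_itv/= in l01.
move=> B Bl; have [//|UB] := in_ultra_setVsetC (f @^-1` B) UU.
by have [x []] := cl (~` B) B UB Bl.
Qed.

(** Taking limits along an ultrafilter makes every point converge at once, with
    no extraction of subsequences. *)
Lemma helly_quantile (R : realType) (U : set_system nat) {UU : UltraFilter U}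
    (s : nat -> seq R) :
  (forall n, sorted <=%R (s n)) -> (forall n, {in s n, forall x, 0 <= x <= 1}) ->
  exists Q : R -> R, [/\ nondecreasing_fun Q, forall u, 0 <= Q u <= 1 &
    forall u, quantile (s n) u @[n --> U] --> Q u].
Proof.
move=> s_sorted s01.
have /choice[Q Q_lim] u : exists l : R, 0 <= l <= 1 /\
    quantile (s n) u @[n --> U] --> l.
  have [n|l] := @ultrafilter_cvg_unit R nat U _ (fun n => quantile (s n) u).
    by rewrite nth_unit.
  by exists l.
exists Q; split => [u v uv|u|u]; [|exact: (Q_lim u).1|exact: (Q_lim u).2].
apply: (ler_cvg_to (Q_lim u).2 (Q_lim v).2); apply: nearW => n.
apply: (nondecreasing_step (size (s n)) _ uv).
by apply: nondecreasing_nth => // x /s01/andP[].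
Qed.

(** Both sides are within eps of their Riemann sums on a grid that does not
    depend on n, and Riemann sums, being finite, converge with the quantiles. *)
Lemma list_mean_cvg_ultra (R : realType) (U : set_system nat) {UU : UltraFilter U}
    (s : nat -> seq R) (Q g : R -> R) :
  (forall n, s n != [::]) -> (forall n, sorted <=%R (s n)) ->
  (forall n, {in s n, forall x, 0 <= x <= 1}) ->
  nondecreasing_fun Q -> (forall u, 0 <= Q u <= 1) ->
  (forall u, quantile (s n) u @[n --> U] --> Q u) ->
  continuous g -> {in [pred x : R | 0 <= x <= 1] &, nondecreasing_fun g} ->
  list_mean (s n) g @[n --> U] --> unit_mean (g \o Q).
Proof.
move=> s0 s_sorted s01 ndQ Q01 Q_lim cg ndg.
have in01 (x : R) : 0 <= x <= 1 -> g 0 <= g x <= g 1.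
  by move=> /[dup] x01 /andP[x0 x1]; rewrite !ndg ?inE ?lexx ?ler01.
pose D := g 1 - g 0.
have D_ge0 : 0 <= D by rewrite subr_ge0 ndg ?inE ?lexx ?ler01.
pose riemann N (G : R -> R) := (\sum_(k < N) G (k%:R / N%:R)) / N%:R.
apply: cvg_uniform_approx => eps eps_gt0.
pose N := (Num.truncn (D / eps)).+1.
have DN : D / N%:R <= eps.
  by rewrite ler_pdivrMr ?ltr0n// mulrC -ler_pdivrMr// ltW// truncnS_gt.
exists (fun n => riemann N (g \o quantile (s n))), (riemann N (g \o Q)).
  rewrite /riemann; apply: cvgMl; apply: (@cvg_big _ _ +%R) => //.
    exact: add_continuous.
  move=> k _.
  by apply: continuous_cvg; [exact: cg|exact: Q_lim].
have close (G : R -> R) : nondecreasing_fun (g \o G) -> (forall u, 0 <= G u <= 1) ->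
    `|unit_mean (g \o G) - riemann N (g \o G)| <= eps.
  move=> ndG G01; apply: le_trans (riemann_sum_nondecreasing _ ndG) _ => //.
  rewrite (le_trans _ DN)// ler_pM2r ?invr_gt0 ?ltr0n//= /D.
  by have := in01 _ (G01 0); have := in01 _ (G01 1); lra.
split; last by apply: close => // u v uv; rewrite /= ndg ?inE// ndQ.
apply: nearW => n.
have [ndn ->] := list_mean_quantile (s0 n) (s_sorted n) (s01 n) ndg.
by apply: close => // u; rewrite nth_unit.
Qed.

(** * From moments to continuous functions *)

Section moments.
Context {R : realType}.
Variable Q : R -> R.
Hypothesis ndQ : nondecreasing_fun Q.
Hypothesis Q01 : forall u, 0 <= Q u <= 1.

Lemma unit_mean_horner (p : {poly R}) :
  unit_mean (horner p \o Q) = \sum_(k < size p) p`_k * unit_mean (fun u => Q u ^+ k).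
Proof.
have iQ k : lebesgue_measure.-integrable `[0, 1] (EFin \o (fun u => Q u ^+ k)).
  apply: nondecreasing_unit_integrable => u v uv.
  by rewrite lerXn2r ?nnegrE ?ndQ//; case/andP: (Q01 u); case/andP: (Q01 v).
have mI : measurable (`[0, 1] : set (measurableTypeR R)) by exact: measurable_itv.
have ipQ (k : 'I_(size p)) :
    lebesgue_measure.-integrable `[0, 1] (fun u => (p`_k * Q u ^+ k)%:E).
  exact: (integrableZl mI p`_k (iQ k)).
apply: EFin_inj; rewrite /unit_mean /Rintegral.
under [in LHS]eq_integral do rewrite /= horner_coef -sumEFin.
rewrite integral_sum//= -sumEFin fineK; last first.
  by apply/sum_fin_numP => k _ _; exact: (integrable_fin_num _ (ipQ k)).
apply: eq_bigr => k _; rewrite -[RHS]/(_%:E * _%:E)%E fineK.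
  by rewrite -(integralZl mI (iQ k)).
exact: (integrable_fin_num _ (iQ k)).
Qed.

Lemma moments_cvg_continuous (s : nat -> seq R) (F : R -> R) :
  (forall n, {in s n, forall x, 0 <= x <= 1}) ->
  (forall k, list_mean (s n) (fun x => x ^+ k) @[n --> \oo] -->
             unit_mean (fun u => Q u ^+ k)) ->
  measurable_fun setT (F \o Q) ->
  (exists M : R, forall x : R, 0 <= x <= 1 -> `|F x| <= M) ->
  (forall eps : R, 0 < eps -> exists2 d : R, 0 < d & forall x y : R,
     0 <= x <= 1 -> 0 <= y <= 1 -> `|x - y| < d -> `|F x - F y| <= eps) ->
  list_mean (s n) F @[n --> \oo] --> unit_mean (F \o Q).
Proof.
move=> s01 moments mF [M F_le] F_uc; apply: cvg_uniform_approx => eps eps_gt0.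
have [p Fp] := weierstrass_approximation (ex_intro _ M F_le) F_uc eps_gt0.
have iF : lebesgue_measure.-integrable `[0, 1] (EFin \o (F \o Q)).
  apply: (@bounded_unit_integrable _ _ M); first exact: measurable_funTS.
  by move=> x _; exact: F_le.
have ip : lebesgue_measure.-integrable `[0, 1] (EFin \o (horner p \o Q)).
  apply: (@bounded_unit_integrable _ _ (M + eps)).
    apply: measurable_funTS; apply: measurableT_comp.
      by apply: continuous_measurable_fun; exact: continuous_horner.
    exact: nondecreasing_measurable.
  move=> x _; rewrite /= (_ : p.[Q x] = F (Q x) - (F (Q x) - p.[Q x])); last by ring.
  by rewrite (le_trans (ler_normB _ _))// lerD ?F_le ?Fp.
have mI : measurable (`[0, 1] : set (measurableTypeR R)) by exact: measurable_itv.
have iFp := integrableB mI iF ip.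
exists (fun n => list_mean (s n) (horner p)), (unit_mean (horner p \o Q)).
  rewrite unit_mean_horner.
  under eq_fun do rewrite list_mean_horner.
  apply: (@cvg_big _ _ +%R) => //; first exact: add_continuous.
  by move=> k _; apply: cvgMr; exact: moments.
split.
  apply: nearW => n; rewrite -list_meanB; apply: list_mean_bound.
    exact: ltW.
  by move=> x /s01; exact: Fp.
rewrite /unit_mean -RintegralB//=.
apply: le_trans (le_normr_Rintegral mI iFp) _.
rewrite [leRHS](_ : _ = \int[lebesgue_measure]_(x in `[(0 : R), 1]) cst eps x).
  apply: le_Rintegral => //.
  - apply: (@bounded_unit_integrable _ _ eps).
      apply: measurableT_comp => //; apply/measurable_EFinP.
      exact: (measurable_int _ iFp).
    by move=> x _; rewrite normr_id; exact: Fp.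
  - apply: (@bounded_unit_integrable _ _ eps) => // x _.
    by rewrite ger0_norm// ltW.
  - by move=> x _; exact: Fp.
rewrite Rintegral_cst//= lebesgue_measure_itv/= lte_fin ltr01/=.
by rewrite subr0 mulr1.
Qed.

End moments.

(** * The half-line [-oo, 0] as the unit interval *)

(** Formulas for integrals of nonnegative functions extend to bounded functions
    of any sign as soon as the candidate value I is additive on the positive and
    negative parts. *)
Lemma integral_by_sign (d : measure_display) (T : measurableType d) (R : realType)
    (mu : {measure set T -> \bar R}) (D : set T) (I : (T -> R) -> R) (f : T -> R) (M : R) :
  measurable_fun D f -> (forall x, D x -> `|f x| <= M) ->
  (forall g : T -> R, measurable_fun D g -> (forall x, 0 <= g x) ->
     (forall x, D x -> g x <= M) ->
     (\int[mu]_(x in D) (g x)%:E = (I g)%:E)%E) ->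
  I f = I (fun x => Num.max (f x) 0) - I (fun x => Num.max (- f x) 0) ->
  (\int[mu]_(x in D) (f x)%:E = (I f)%:E)%E.
Proof.
move=> mf fM I_ge0 If; rewrite integralE.
under eq_integral do rewrite funeposE -EFin_max.
under [X in (_ - X)%E]eq_integral do rewrite funenegE -EFinN -EFin_max.
rewrite !I_ge0 -?EFinB ?If//.
- by apply: measurable_maxr => //; exact: measurableT_comp.
- by move=> x; rewrite le_max lexx orbT.
- move=> x /fM fxM; rewrite ge_max (le_trans (normr_ge0 _) fxM).
  by rewrite (le_trans _ fxM)// -normrN ler_norm.
- exact: measurable_maxr.
- by move=> x; rewrite le_max lexx orbT.
- move=> x /fM fxM; rewrite ge_max (le_trans (normr_ge0 _) fxM).
  by rewrite (le_trans _ fxM)// ler_norm.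
Qed.

Lemma max0_sub_maxN (R : realDomainType) (x : R) :
  x = Num.max x 0 - Num.max (- x) 0.
Proof. by rewrite !maxEle oppr_le0; case: (ltgtP x 0) => //; lra. Qed.

(** On [-oo, 0], 1 + z/(1 + |z|) is 1/(1 - z), the coordinate in which Cauchy
    kernels become u/(1 + s u).  Written with [contract] it is an isometry for
    the metric of the extended reals. *)
Definition unit_of_ereal (R : realType) (z : \bar R) : R := 1 + contract z.

Definition ereal_of_unit (R : realType) (u : R) : \bar R := expand (u - 1).

Section compactification.
Context {R : realType}.
Implicit Types (z : \bar R) (u x y : R) (f : \bar R -> R).

Lemma unit_of_erealK z : ereal_of_unit (unit_of_ereal z) = z.
Proof. by rewrite /ereal_of_unit /unit_of_ereal addrC addKr contractK. Qed.

Lemma ereal_of_unitK u : 0 <= u <= 1 -> unit_of_ereal (ereal_of_unit u) = u.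
Proof.
move=> u01; rewrite /unit_of_ereal expandK ?subrKC// inE/= ler_norml.
by apply/andP; split; lra.
Qed.

Lemma unit_of_ereal_itv z : (z <= 0)%E -> 0 <= unit_of_ereal z <= 1.
Proof.
move=> z0; rewrite /unit_of_ereal -lerBlDl sub0r gerDl.
have := contract_le1 z; rewrite ler_norml => /andP[-> _] /=.
by rewrite -(@contract0 R) le_contract.
Qed.

Lemma ereal_of_unit_le0 u : u <= 1 -> (ereal_of_unit u <= 0)%E.
Proof. by move=> u1; rewrite -(@expand0 R) le_expand// subr_le0. Qed.

Lemma unit_of_erealE (r : R) : r <= 0 -> unit_of_ereal r%:E = (1 - r)^-1.
Proof.
move=> r0; rewrite /unit_of_ereal/= ler0_norm//.
by field; rewrite gt_eqF//; lra.
Qed.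

Lemma measurable_unit_of_ereal (D : set (\bar R)) :
  measurable D -> measurable_fun D (@unit_of_ereal R).
Proof.
move=> mD; apply: (measurability _ (RGenCInfty.measurableE R)) => // _ /= -[_ [r ->] <-].
apply: measurableI => //.
have -> : (@unit_of_ereal R) @^-1` `[r, +oo[ = [set z | r - 1 <= contract z].
  by apply/seteqP; split => z /=; rewrite in_itv/= andbT lerBlDl.
have [r1|r1] := leP `|r - 1| 1.
  rewrite (_ : [set _ | _] = [set` `[expand (r - 1), +oo[ ]).
    exact: emeasurable_itv.
  by apply/seteqP; split => z /=; rewrite in_itv/= andbT le_expandLR.
have [rN|r_gt] := leP (r - 1) 0.
  rewrite (_ : [set _ | _] = setT); first exact: measurableT.
  apply/seteqP; split => // z _ /=; rewrite ler0_norm// in r1.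
  by have := contract_le1 z; rewrite ler_norml => /andP[+ _]; lra.
rewrite (_ : [set _ | _] = set0); first exact: measurable0.
apply/seteqP; split => // z /=; rewrite gtr0_norm// in r1.
by have := contract_le1 z; rewrite ler_norml => /andP[_ +]; lra.
Qed.

Lemma measurable_ereal_of_unit (Q : R -> R) :
  nondecreasing_fun Q -> measurable_fun setT (@ereal_of_unit R \o Q).
Proof.
move=> ndQ; apply: (measurability _ (ErealGenCInfty.measurableE R)) => // _ /= -[_ [r ->] <-].
rewrite setTI; apply: is_interval_measurable => s t/=.
rewrite !in_itv/= !andbT => rs rt u /andP[su ut].
by rewrite in_itv/= andbT (le_trans rs)// le_expand// lerB// ndQ.
Qed.

Lemma continuous_ereal_of_unit f : {within nonpos_ereal R, continuous f} ->
  {within `[0, 1], continuous (f \o @ereal_of_unit R)}.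
Proof.
move=> /subspace_continuousP cf; apply/subspace_continuousP => x.
rewrite /= in_itv/= => /andP[x0 x1] A /(cf _ (ereal_of_unit_le0 x1)).
move=> /nbhs_ballP[e /= e_gt0 xA]; apply/nbhs_ballP; exists e => //= y xy.
rewrite in_itv/= => /andP[y0 y1]; apply: xA; last exact: ereal_of_unit_le0.
rewrite /ball/= /ereal_ball.
(* [ereal_of_unit] is an isometry on the unit interval. *)
move: xy; rewrite /ball/= -[X in X < _ -> _](_ : `|(unit_of_ereal (ereal_of_unit x) - unit_of_ereal (ereal_of_unit y))| = _).
  by rewrite /unit_of_ereal opprD addrACA subrr add0r.
by rewrite !ereal_of_unitK ?x0 ?y0.
Qed.

(** Uniform continuity on the compact [0, 1], obtained by covering it with
    neighbourhoods on which a common d works. *)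
Lemma heine_unit (F : R -> R) : {within `[0, 1], continuous F} ->
  forall eps : R, 0 < eps -> exists2 d : R, 0 < d & forall x y : R,
    0 <= x <= 1 -> 0 <= y <= 1 -> `|x - y| < d -> `|F x - F y| <= eps.
Proof.
move=> /subspace_continuousP cF eps eps_gt0.
have eps2_gt0 : 0 < eps / 2 by rewrite divr_gt0.
have /compact_near_coveringP/near_covering_withinP := @segment_compact R 0 1.
move=> /(_ _ 0^'+ (fun d x => forall y, 0 <= y <= 1 -> `|x - y| < d -> `|F x - F y| <= eps)).
have cover x : x \in `[0, 1] -> \forall x' \near x & d \near 0^'+, x' \in `[0, 1] ->
    forall y, 0 <= y <= 1 -> `|x' - y| < d -> `|F x' - F y| <= eps.
  move=> /[dup] x01 /cF /cvgrPdist_le/(_ _ eps2_gt0) /nbhs_ballP[r /= r_gt0 xr].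
  have r2_gt0 : 0 < r / 2 by rewrite divr_gt0.
  exists (ball x (r / 2), [set d | d <= r / 2]) => /=.
    split; first exact: nbhsx_ballx.
    exact: nbhs_right_le.
  move=> [x' d] [/= xx' dr] x'01 y y01 x'y.
  have Fx' : `|F x - F x'| <= eps / 2.
    by apply: xr => //; apply: lt_trans xx' _; lra.
  have Fy : `|F x - F y| <= eps / 2.
    apply: xr; last by rewrite /= in_itv.
    rewrite /ball/= (_ : x - y = (x - x') + (x' - y)); last by ring.
    by apply: le_lt_trans (ler_normD _ _) _; move: xx'; rewrite /ball/=; lra.
  rewrite (_ : F x' - F y = (F x - F y) - (F x - F x')); last by ring.
  by apply: le_trans (ler_normB _ _) _; lra.
move=> /(_ _ cover) near_d.
have [d [d_gt0 dP]] : exists d : R, 0 < d /\ (`[0, 1]%classic `<=` (fun x => forall y,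
    0 <= y <= 1 -> `|x - y| < d -> `|F x - F y| <= eps)).
  have := filterI (nbhs_right_gt (0 : R)) near_d.
  by move=> /(_ _)/filter_ex[d []]; exists d.
by exists d => // x y x01; apply: dP; rewrite /= in_itv.
Qed.

Lemma bounded_unit (F : R -> R) : {within `[0, 1], continuous F} ->
  exists M : R, forall x : R, 0 <= x <= 1 -> `|F x| <= M.
Proof.
move=> cF; have := continuous_compact cF (@segment_compact R 0 1).
move=> /compact_bounded[M [_ FM]]; exists (M + 1) => x x01.
by apply: FM; [rewrite ltrDl|exists x => //=; rewrite in_itv].
Qed.

Lemma bounded_within_nonpos f : {within nonpos_ereal R, continuous f} ->
  exists M : R, forall z, nonpos_ereal R z -> `|f z| <= M.
Proof.
move=> /continuous_ereal_of_unit/bounded_unit[M FM]; exists M => z z0.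
by have := FM _ (unit_of_ereal_itv z0); rewrite /= unit_of_erealK.
Qed.

End compactification.

(** * A continuity theorem for Stieltjes transforms *)

Lemma list_mean_sort (R : realType) (s : seq R) (f : R -> R) :
  list_mean (sort <=%R s) f = list_mean s f.
Proof.
by rewrite /list_mean size_sort; congr (_ / _); apply: perm_big; rewrite perm_sort.
Qed.

Lemma measurable_nonpos_ereal (R : realType) : measurable (nonpos_ereal R).
Proof.
rewrite (_ : nonpos_ereal R = [set` `]-oo, 0%E]]); first exact: emeasurable_itv.
by apply/seteqP; split => z /=; rewrite in_itv.
Qed.

Lemma measurable_within_nonpos (R : realType) (f : \bar R -> R) :
  {within nonpos_ereal R, continuous f} -> measurable_fun (nonpos_ereal R) f.
Proof.
move=> cf; have mK := @measurable_nonpos_ereal R.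
rewrite (_ : f = (f \o @ereal_of_unit R) \o @unit_of_ereal R); last first.
  by apply/funext => z /=; rewrite unit_of_erealK.
apply: (@measurable_comp _ _ _ _ _ _ (`[(0 : R), 1])).
- exact: measurable_itv.
- by move=> _ [z z0 <-] /=; rewrite in_itv; exact: unit_of_ereal_itv.
- apply: subspace_continuous_measurable_fun; first exact: measurable_itv.
  exact: continuous_ereal_of_unit.
- exact: measurable_unit_of_ereal.
Qed.

Section quantile_law.
Context {R : realType}.
Variable Q : R -> R.
Hypothesis ndQ : nondecreasing_fun Q.
Hypothesis Q01 : forall u, 0 <= Q u <= 1.

(** The law is the image of the uniform probability on [0, 1] under the quantile
    function Q, read in [-oo, 0]. *)
Lemma quantile_law : exists mu : probability (\bar R) R,
  mu (nonpos_ereal R) = 1%E /\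
  forall f : \bar R -> R, {within nonpos_ereal R, continuous f} ->
    (\int[mu]_(z in nonpos_ereal R) (f z)%:E)%E =
    (unit_mean (f \o @ereal_of_unit R \o Q))%:E.
Proof.
have mX : measurable_fun setT (@ereal_of_unit R \o Q : measurableTypeR R -> \bar R).
  exact: measurable_ereal_of_unit.
pose X : {mfun measurableTypeR R >-> \bar R} :=
  HB.pack (@ereal_of_unit R \o Q) (isMeasurableFun.Build _ _ _ _ _ mX).
have X_le0 : X @^-1` nonpos_ereal R = setT.
  apply/seteqP; split => // u _; rewrite /= /nonpos_ereal/=.
  by apply: ereal_of_unit_le0; case/andP: (Q01 u).
have mK := @measurable_nonpos_ereal R.
exists (distribution (uniform_prob (@ltr01 R)) X); split.
  rewrite -[RHS](probability_setT (uniform_prob (@ltr01 R))) -X_le0.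
  by [].
move=> f cf; pose I (g : \bar R -> R) := unit_mean (g \o X).
have mf := measurable_within_nonpos cf.
have mgX (g : \bar R -> R) : measurable_fun (nonpos_ereal R) g ->
    measurable_fun setT (g \o X : measurableTypeR R -> R).
  move=> mg; apply: (measurable_comp mK _ mg mX) => _ [u _ <-] /=.
  by have : setT u by []; rewrite -X_le0.
have [M fM] := bounded_within_nonpos cf.
have igX (g : \bar R -> R) : measurable_fun (nonpos_ereal R) g ->
    (forall z, nonpos_ereal R z -> `|g z| <= M) ->
    lebesgue_measure.-integrable `[0, 1] (EFin \o (g \o X)).
  move=> mg gM; apply: (@bounded_unit_integrable _ _ M).
    by apply: measurable_funTS; exact: (mgX g mg).
  by move=> u _; apply: gM; have : setT u by []; rewrite -X_le0.
apply: (@integral_by_sign _ _ _ _ _ I _ M) => //.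
  move=> g mg g0 gM; rewrite ge0_integral_pushforward//; last 2 first.
  - exact/measurable_EFinP.
  - by move=> z _; rewrite lee_fin.
  rewrite X_le0 integral_uniform; last 2 first.
  - by apply/measurable_EFinP; exact: (mgX g mg).
  - by move=> u; rewrite lee_fin.
  rewrite subr0 invr1 mul1e /I /unit_mean /Rintegral fineK//.
  apply: integrable_fin_num => //; apply: (igX g) => // z /gM.
  by rewrite ger0_norm.
rewrite /I /unit_mean -RintegralB//=.
- by apply: eq_Rintegral => u _; exact: max0_sub_maxN.
- apply: (igX (fun z => Num.max (f z) 0)); first exact: measurable_maxr.
  move=> z /fM; apply: le_trans; rewrite ger0_norm ?le_max ?lexx ?orbT//.
  by rewrite ge_max ler_norm normr_ge0.
- apply: (igX (fun z => Num.max (- f z) 0)).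
    by apply: measurable_maxr => //; exact: measurableT_comp.
  move=> z /fM; apply: le_trans; rewrite ger0_norm ?le_max ?lexx ?orbT//.
  by rewrite ge_max normr_ge0 -normrN ler_norm.
Qed.

End quantile_law.

(** The moments converge along the whole sequence, and along an ultrafilter they
    converge to those of a quantile function; so the latter are the limits. *)
Lemma helly_stieltjes (R : realType) (s : nat -> seq R) :
  (forall n, s n != [::]) -> (forall n, {in s n, forall x, 0 <= x <= 1}) ->
  (forall t : R, 0 <= t ->
     cvgn (fun n => list_mean (s n) (fun x => x / (1 + t * x)))) ->
  exists mu : probability (\bar R) R, mu (nonpos_ereal R) = 1%E /\
  forall f : \bar R -> R, {within nonpos_ereal R, continuous f} ->
    (list_mean (s n) (f \o @ereal_of_unit R))%:E @[n --> \oo] -->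
    (\int[mu]_(z in nonpos_ereal R) (f z)%:E)%E.
Proof.
move=> s0 s01 stieltjes.
have [U [UU ooU]] := ultraFilterLemma eventually_filter.
pose s' n := sort <=%R (s n).
have s'0 n : s' n != [::] by rewrite -size_eq0 size_sort size_eq0.
have s'_sorted n : sorted <=%R (s' n) by exact: sort_le_sorted.
have s'01 n : {in s' n, forall x, 0 <= x <= 1}.
  by move=> x; rewrite mem_sort; exact: s01.
have [Q [ndQ Q01 Q_lim]] := helly_quantile s'_sorted s'01.
have [mu [muK muE]] := quantile_law ndQ Q01.
exists mu; split => // f cf; rewrite muE//; apply: cvg_EFin; first exact: nearW.
have cF := continuous_ereal_of_unit cf.
apply: (moments_cvg_continuous ndQ Q01 s01); last 2 first.
- exact: bounded_unit.
- exact: heine_unit.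
- move=> k; have lim_U : list_mean (s n) (fun x => x ^+ k) @[n --> U] -->
      unit_mean (fun u => Q u ^+ k).
    under eq_fun do rewrite -list_mean_sort.
    apply: (list_mean_cvg_ultra s'0 s'_sorted s'01 ndQ Q01 Q_lim (g := fun x => x ^+ k)).
      exact: exprn_continuous.
    move=> x y; rewrite !inE => /andP[x0 _] /andP[y0 _] xy.
    by rewrite lerXn2r.
  suff lim_oo : cvgn (fun n => list_mean (s n) (fun x => x ^+ k)).
    have lim_oo_U := cvg_trans (cvg_app _ ooU) lim_oo.
    by rewrite (cvg_unique (@Rhausdorff R) lim_U lim_oo_U).
  case: k {lim_U} => [|k]; last exact: stieltjes_cvg_moments.
  rewrite (_ : (fun n => _) = cst 1); first exact: is_cvg_cst.
  apply/funext => n; rewrite /list_mean big_const_seq count_predT iter_addr_0.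
  by rewrite divff// pnatr_eq0 size_eq0.
apply: (@measurable_comp _ _ _ _ _ _ (`[(0 : R), 1])).
- exact: measurable_itv.
- by move=> _ [u _ <-]; rewrite /= in_itv/= Q01.
- by apply: subspace_continuous_measurable_fun; first exact: measurable_itv.
- exact: nondecreasing_measurable.
Qed.

(** * Weights and zeros of the hypergeometric polynomials *)

Definition shift_ratio (R : realType) (i j : nat) (a : 'rV[R]_i) (b : 'rV[R]_j)
    (alpha : R) : R :=
  (\prod_(s < j) (b ord0 s - 1 + alpha)) / (\prod_(s < i) (a ord0 s - 1 + alpha)).

Definition hyp_weight (R : realType) (i j : nat) (a : 'rV[R]_i) (b : 'rV[R]_j)
    (n k : nat) : R :=
  n%:R ^ ((i%:Z - j%:Z) * (n - k)%N%:Z)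
    * (falling_vec b n (n - k) / falling_vec a n (n - k)).

Lemma prod_shift_neq0 (R : realType) (p : nat) (c : 'rV[R]_p) (alpha : R) :
  (forall s : 'I_p, ~ (0 <= c ord0 s < 1)) -> 0 < alpha <= 1 ->
  \prod_(s < p) (c ord0 s - 1 + alpha) != 0.
Proof.
move=> c_range /andP[al0 al1]; rewrite prodf_seq_neq0; apply/allP => s _ /=.
apply/eqP => c_al; apply: (c_range s).
by rewrite (_ : c ord0 s = 1 - alpha); [lra|move: c_al; lra].
Qed.

Lemma falling_vecS (R : realType) (p : nat) (c : 'rV[R]_p) (n k : nat) :
  (k < n)%N ->
  falling_vec c n (n - k) = falling_vec c n (n - k.+1) *
    (n%:R ^+ p * \prod_(s < p) (c ord0 s - 1 + k.+1%:R / n%:R)).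
Proof.
move=> kn; have n_gt0 : (0 < n)%N by exact: leq_ltn_trans kn.
rewrite -(subnSK kn) /falling_vec.
have -> : n%:R ^+ p = \prod_(s < p) n%:R :> R by rewrite prodr_const card_ord.
rewrite -!big_split/=; apply: eq_bigr => s _.
rewrite /falling big_ord_recr/=; congr (_ * _).
by rewrite natrB//; field; rewrite pnatr_eq0 -lt0n.
Qed.

Section hyp_poly.
Context {R : realType} {i j : nat}.
Variables (a : 'rV[R]_i) (b : 'rV[R]_j).
Hypothesis a_range : forall s : 'I_i, ~ (0 <= a ord0 s < 1).
Hypothesis b_range : forall s : 'I_j, ~ (0 <= b ord0 s < 1).

Local Notation g := (shift_ratio a b).
Local Notation q := (hyp_weight a b).

Lemma shift_ratio_neq0 (alpha : R) : 0 < alpha <= 1 -> g alpha != 0.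
Proof.
by move=> al01; rewrite mulf_neq0 ?invr_eq0 ?prod_shift_neq0.
Qed.

Lemma continuous_prod_shift (p : nat) (c : 'rV[R]_p) :
  continuous (fun alpha => \prod_(s < p) (c ord0 s - 1 + alpha)).
Proof.
move=> x; apply: (@cvg_big R _ *%R 1 _ _ _ (nbhs x) _
  (fun s alpha => c ord0 s - 1 + alpha)) => //; first exact: mul_continuous.
by move=> s _; apply: cvgD; [exact: cvg_cst|exact: cvg_id].
Qed.

Lemma continuous_shift_ratio (alpha : R) : 0 < alpha <= 1 ->
  {for alpha, continuous g}.
Proof.
move=> al01; apply: cvgM; first exact: continuous_prod_shift.
by apply: cvgV; [exact: prod_shift_neq0|exact: continuous_prod_shift].
Qed.

(** The power of n in the coefficients is chosen so that this ratio depends on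
    k and n through (k + 1)/n only. *)
Lemma hyp_weightS (n k : nat) : (k < n)%N -> q n k = q n k.+1 * g (k.+1%:R / n%:R).
Proof.
move=> kn; have n_gt0 : (0 < n)%N by exact: leq_ltn_trans kn.
have n0 : n%:R != 0 :> R by rewrite pnatr_eq0 -lt0n.
rewrite /hyp_weight !(falling_vecS _ kn) /shift_ratio -(subnSK kn).
set r := (n - k.+1)%N.
have -> : (i%:Z - j%:Z) * r.+1%:Z = (i%:Z - j%:Z) * r%:Z + i%:Z - j%:Z by lia.
rewrite !expfzDr// -exprnN -exprnP.
rewrite !invfM; set A := \prod_(s < i) _; set B := \prod_(s < j) _.
set fA := falling_vec a n r; set fB := falling_vec b n r.
set x := n%:R ^ _.
transitivity (x * (fB / fA) * (B / A) * (n%:R ^+ i / n%:R ^+ i) * (n%:R ^+ j / n%:R ^+ j)).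
  by ring.
by rewrite !divff ?expf_neq0// !mulr1.
Qed.

Lemma hyp_weight_n (n : nat) : q n n = 1.
Proof.
rewrite /hyp_weight subnn mulr0 expr0z mul1r /falling_vec.
by rewrite !big1 ?divr1// => s _; rewrite /falling big_ord0.
Qed.

Lemma hyp_weight_neq0 (n k : nat) : (k <= n)%N -> q n k != 0.
Proof.
move=> kn; rewrite -(subKn kn); elim: (n - k)%N (leq_subr k n) => [|m IHm] mn.
  by rewrite subn0 hyp_weight_n oner_eq0.
have mn' : (n - m.+1 < n)%N by rewrite ltn_subrL (leq_ltn_trans _ mn).
rewrite hyp_weightS// subnSK// mulf_neq0 ?IHm ?(ltnW mn)//.
have n_gt0 : (0 < n)%N by exact: leq_ltn_trans mn.
apply: shift_ratio_neq0; rewrite divr_gt0 ?ltr0n ?subn_gt0//=.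
by rewrite ler_pdivrMr ?ltr0n// mul1r ler_nat leq_subr.
Qed.

Lemma coef_hyp_poly (n k : nat) : (hyp_poly a b n)`_k = 'C(n, k)%:R * q n k.
Proof.
rewrite coef_poly; case: ltnP => kn; first by rewrite /hyp_weight -[LHS]mulrA.
by rewrite bin_small// mul0r.
Qed.

Lemma size_hyp_poly (n : nat) : size (hyp_poly a b n) = n.+1.
Proof.
apply: size_poly_eq; rewrite subnn.
by have := coef_hyp_poly n n; rewrite coef_poly ltnSn subnn => ->;
  rewrite binn mul1r hyp_weight_n oner_eq0.
Qed.

Lemma hyp_poly_monic (n : nat) : hyp_poly a b n \is monic.
Proof.
by rewrite monicE lead_coefE size_hyp_poly/= coef_hyp_poly binn mul1r hyp_weight_n.
Qed.

(** The zeros are negative, not merely nonpositive, because the constant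
    coefficient does not vanish. *)
Lemma hyp_poly_zeros (n : nat) : only_real_nonpos_roots (hyp_poly a b n) ->
  let zs := [seq complex.Re z | z <- complex_zeros (hyp_poly a b n)] in
  [/\ size zs = n, {in zs, forall x, x < 0} &
      hyp_poly a b n = \prod_(x <- zs) ('X - x%:P)].
Proof.
move=> real_roots zs; set P := hyp_poly a b n.
set Z := complex_zeros P in zs *.
have cP_monic : lead_coef (to_complex_poly P) = 1.
  by rewrite lead_coef_map (monicP (hyp_poly_monic n)) rmorph1.
have cPE : to_complex_poly P = \prod_(z <- Z) ('X - z%:P).
  rewrite [LHS](svalP (closed_field_poly_normal (to_complex_poly P))) -/Z.
  by rewrite [X in X *: _](_ : _ = 1) ?scale1r.
have Z_root z : z \in Z -> root (to_complex_poly P) z.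
  by rewrite cPE root_prod_XsubC.
have Z_real z : z \in Z -> z = real_complex R (complex.Re z).
  by move=> /Z_root/real_roots[Im0 _]; case: z Im0 => x y /= ->.
have PE : P = \prod_(x <- zs) ('X - x%:P).
  apply: (@map_poly_inj _ _ (real_complex R)).
  rewrite -[LHS]/(to_complex_poly P) cPE rmorph_prod big_map big_seq [RHS]big_seq.
  apply: eq_bigr => z zZ; rewrite rmorphB/= map_polyX map_polyC/=.
  by rewrite {1}(Z_real z zZ).
split => //.
  have := size_hyp_poly n; rewrite -/P PE size_prod_XsubC.
  by case.
move=> x xzs; have [z zZ xE] := mapP xzs.
rewrite lt_neqAle; apply/andP; split; last first.
  by rewrite xE; have [] := real_roots z (Z_root z zZ).
apply/eqP => x0; have : root P 0 by rewrite PE root_prod_XsubC -x0.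
rewrite /root horner_coef0 coef_hyp_poly bin0 mul1r.
by apply/negP; exact: hyp_weight_neq0.
Qed.

End hyp_poly.

(** * Monotonicity of the ratio and convergence of the Cauchy transforms *)

Lemma log_deriv_prod_XsubC (R : fieldType) (zs : seq R) (t : R) : t \notin zs ->
  (\prod_(x <- zs) ('X - x%:P))^`().[t] =
  (\prod_(x <- zs) ('X - x%:P)).[t] * \sum_(x <- zs) (t - x)^-1.
Proof.
elim: zs => [|x zs IHzs]; first by rewrite !big_nil mulr0 derivC horner0.
rewrite in_cons negb_or => /andP[tx tzs]; rewrite !big_cons derivM hornerD !hornerM.
rewrite IHzs// derivXsubC hornerC mul1r hornerXsubC.
by field; rewrite subr_eq0.
Qed.

Lemma truncn_div_cvg (R : realType) (alpha : R) : 0 <= alpha ->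
  (Num.truncn (n%:R * alpha))%:R / n%:R @[n --> \oo] --> alpha.
Proof.
move=> al0; apply/cvgrPdist_le => eps eps_gt0; near=> n.
have n_gt0 : 0 < n%:R :> R by rewrite ltr0n; near: n; exact: nbhs_infty_gt.
have /andP[lo hi] := truncn_itv (mulr_ge0 (ltW n_gt0) al0).
have neps : eps^-1 <= n%:R.
  rewrite (le_trans (ltW (truncnS_gt _)))// ler_nat.
  by near: n; exact: nbhs_infty_ge.
rewrite ger0_norm; last by rewrite subr_ge0 ler_pdivrMr// [leRHS]mulrC.
rewrite -(ler_pM2r n_gt0) mulrBl divfK ?gt_eqF// [alpha * _]mulrC.
apply: (@le_trans _ _ 1); first by move: hi; rewrite -natr1; lra.
by rewrite mulrC -ler_pdivrMr// div1r.
Unshelve. all: by end_near. Qed.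

Section zeros_hyp_poly.
Context {R : realType} {i j : nat}.
Variables (a : 'rV[R]_i) (b : 'rV[R]_j).
Hypothesis a_range : forall s : 'I_i, ~ (0 <= a ord0 s < 1).
Hypothesis b_range : forall s : 'I_j, ~ (0 <= b ord0 s < 1).

Local Notation g := (shift_ratio a b).
Local Notation q := (hyp_weight a b).
Local Notation zeros n :=
  [seq complex.Re z | z <- complex_zeros (hyp_poly a b n)].

Lemma hyp_weight_newton (n : nat) : only_real_nonpos_roots (hyp_poly a b n) ->
  (forall k, (k <= n)%N -> 0 < q n k) /\
  (forall k, (k.+2 <= n)%N -> q n k * q n k.+2 <= q n k.+1 ^+ 2).
Proof.
move=> /(hyp_poly_zeros a_range b_range)[size_zs zs_lt0 PE].
have [x|q' [q'_gt0 q'_lc q'_coef]] := @newton_inequalities R [seq - x | x <- zeros n].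
  by move=> /mapP[y /zs_lt0 y_lt0 ->]; rewrite oppr_gt0.
rewrite size_map size_zs in q'_gt0 q'_lc q'_coef.
have qE k : (k <= n)%N -> q' k = q n k.
  move=> kn; have := q'_coef k; rewrite big_map.
  under eq_bigr do rewrite polyCN.
  rewrite -PE coef_hyp_poly => /mulfI <- //.
  by rewrite pnatr_eq0 -lt0n bin_gt0.
split=> k kn; first by rewrite -qE ?q'_gt0.
by rewrite -!qE ?q'_lc//; lia.
Qed.

(** The ratio of consecutive weights is positive and, by Newton's inequalities,
    monotone. *)
Lemma shift_ratio_grid (n : nat) : only_real_nonpos_roots (hyp_poly a b n) ->
  forall k l, (0 < k)%N -> (k <= l <= n)%N ->
  0 < g (k%:R / n%:R) <= g (l%:R / n%:R).
Proof.
move=> /hyp_weight_newton[q_gt0 q_lc] k l k_gt0 /andP[kl ln].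
have n_gt0 : (0 < n)%N by lia.
have gE m : (m < n)%N -> g (m.+1%:R / n%:R) = q n m / q n m.+1.
  move=> mn; rewrite (hyp_weightS a b mn) mulrAC divff ?mul1r//.
  by rewrite gt_eqF// q_gt0.
apply/andP; split.
  by case: k k_gt0 kl => // k _ kl; rewrite gE ?divr_gt0 ?q_gt0//; lia.
elim: l kl ln => [|l IHl]; first by case: k k_gt0.
rewrite leq_eqVlt => /orP[/eqP -> //|]; rewrite ltnS => kl ln.
apply: le_trans (IHl kl (ltnW ln)) _; case: l kl ln {IHl} => [|l] kl ln.
  by case: k k_gt0 kl.
rewrite !gE ?(ltnW ln)// ler_pdivrMr ?q_gt0 ?(ltnW ln)//.
rewrite mulrAC ler_pdivlMr ?q_gt0// -expr2; exact: q_lc.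
Qed.

Hypothesis real_rooted :
  \forall n \near \oo, only_real_nonpos_roots (hyp_poly a b n).

(** Continuity carries the inequalities over from the grid points
    [truncn (n * alpha) / n]; strict positivity survives in the limit because
    the ratio has no zero on ]0, 1]. *)
Lemma shift_ratio_nondecreasing (alpha beta : R) :
  0 < alpha -> alpha <= beta -> beta <= 1 -> 0 < g alpha <= g beta.
Proof.
move=> al_gt0 al_be be_le1.
have be_gt0 := lt_le_trans al_gt0 al_be.
have grid_cvg x : 0 < x <= 1 ->
    g ((Num.truncn (n%:R * x))%:R / n%:R) @[n --> \oo] --> g x.
  move=> x01; apply: continuous_cvg; first exact: continuous_shift_ratio.
  by apply: truncn_div_cvg; case/andP: x01 => /ltW.
have grid_le : \forall n \near \oo,
    0 < g ((Num.truncn (n%:R * alpha))%:R / n%:R) <=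
        g ((Num.truncn (n%:R * beta))%:R / n%:R).
  near=> n.
  have n_gt0 : 0 < n%:R :> R by rewrite ltr0n; near: n; exact: nbhs_infty_gt.
  apply: shift_ratio_grid; first by near: n.
  - rewrite truncn_gt0 mulrC -ler_pdivrMl// mulr1.
    rewrite (le_trans (ltW (truncnS_gt _)))// ler_nat.
    by near: n; exact: nbhs_infty_ge.
  - rewrite le_truncn ?ler_pM2l//= -[leqRHS](@natrK R) le_truncn//.
    by rewrite ler_piMr// ltW.
have al01 : 0 < alpha <= 1 by rewrite al_gt0 (le_trans al_be).
have be01 : 0 < beta <= 1 by rewrite be_gt0.
apply/andP; split.
  rewrite lt_neqAle eq_sym shift_ratio_neq0//=.
  apply: (ler_cvg_to (cvg_cst 0) (grid_cvg _ al01)).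
  by apply: filterS grid_le => n /andP[/ltW].
apply: (ler_cvg_to (grid_cvg _ al01) (grid_cvg _ be01)).
by apply: filterS grid_le => n /andP[].
Unshelve. all: by end_near. Qed.

Lemma shift_ratio_gt0 (alpha : R) : 0 < alpha <= 1 -> 0 < g alpha.
Proof.
by move=> /andP[al0 al1]; have /andP[] := shift_ratio_nondecreasing al0 (lexx _) al1.
Qed.

Lemma hyp_ratio_gt0 (alpha : R) : 0 < alpha < 1 -> 0 < hyp_ratio a b alpha.
Proof.
move=> /andP[al0 al1]; apply: mulr_gt0; first by rewrite divr_gt0 ?subr_gt0.
by apply: shift_ratio_gt0; rewrite al0 ltW.
Qed.

Lemma hyp_ratio_increasing (alpha beta : R) : 0 < alpha -> alpha < beta -> beta < 1 ->
  hyp_ratio a b alpha < hyp_ratio a b beta.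
Proof.
move=> al0 al_be be1.
have /andP[g_gt0 g_le] := shift_ratio_nondecreasing al0 (ltW al_be) (ltW be1).
have al1 := lt_trans al_be be1.
apply: (@lt_le_trans _ _ (beta / (1 - beta) * g alpha)); last first.
  by rewrite ler_wpM2l// divr_ge0 ?subr_ge0 ?(ltW be1)// ltW// (lt_trans al0).
rewrite ltr_pM2r// ltr_pdivrMr ?subr_gt0// mulrAC ltr_pdivlMr ?subr_gt0//.
by lra.
Qed.

Lemma hyp_ratio_continuous (alpha : R) : 0 < alpha < 1 ->
  {for alpha, continuous (hyp_ratio a b)}.
Proof.
move=> /andP[al0 al1]; apply: cvgM.
  apply: cvgM; first exact: cvg_id.
  apply: cvgV; first by rewrite subr_eq0 gt_eqF.
  by apply: cvgB; [exact: cvg_cst|exact: cvg_id].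
by apply: continuous_shift_ratio => //; rewrite al0 ltW.
Qed.

(** Monotonicity of g gives r(u) <= u/(1 - u) g(1/2) for u <= 1/2 and the
    reverse inequality for u >= 1/2, hence the limits 0 and +oo of r at the two
    ends, even when the factors of g vanish at 0. *)
Lemma hyp_ratio_surjective (y : R) : 0 < y ->
  exists2 alpha, 0 < alpha < 1 & hyp_ratio a b alpha = y.
Proof.
move=> y_gt0; have [G GE] : exists G, G = g (1 / 2) by exists (g (1 / 2)).
have G_gt0 : 0 < G by rewrite GE; apply: shift_ratio_gt0; lra.
have lo : exists2 u : R, 0 < u <= 1 / 2 & hyp_ratio a b u <= y.
  exists (Num.min (1 / 2) (y / (2 * G))).
    by rewrite lt_min ge_min lexx divr_gt0//= divr_gt0// mulr_gt0.
  set u := Num.min _ _.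
  have u_gt0 : 0 < u by rewrite lt_min divr_gt0//= divr_gt0// mulr_gt0.
  have u_le : u <= 1 / 2 by rewrite ge_min lexx.
  have u_le' : u * (2 * G) <= y.
    by rewrite -ler_pdivlMr ?mulr_gt0// /u ge_min lexx orbT.
  have /andP[_ gG] : 0 < g u <= G by rewrite GE; apply: shift_ratio_nondecreasing => //; lra.
  apply: le_trans (_ : u / (1 - u) * G <= y).
    by rewrite ler_wpM2l// divr_ge0//; lra.
  rewrite mulrAC ler_pdivrMr; last by lra.
  apply: le_trans (_ : y * (1 / 2) <= _); last by rewrite ler_pM2l//; lra.
  by lra.
have hi : exists2 v : R, 1 / 2 <= v < 1 & y <= hyp_ratio a b v.
  exists (1 - Num.min (1 / 2) (G / (2 * y))).
    set d := Num.min _ _.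
    have d_gt0 : 0 < d by rewrite lt_min divr_gt0//= divr_gt0// mulr_gt0.
    have d_le : d <= 1 / 2 by rewrite ge_min lexx.
    by lra.
  set d := Num.min _ _.
  have d_gt0 : 0 < d by rewrite lt_min divr_gt0//= divr_gt0// mulr_gt0.
  have d_le : d <= 1 / 2 by rewrite ge_min lexx.
  have d_le' : d * (2 * y) <= G.
    by rewrite -ler_pdivlMr ?mulr_gt0// /d ge_min lexx orbT.
  have /andP[_ Gg] : 0 < G <= g (1 - d) by rewrite GE; apply: shift_ratio_nondecreasing; lra.
  apply: le_trans (_ : (1 - d) / (1 - (1 - d)) * G <= _); last first.
    by rewrite ler_wpM2l// divr_ge0//; lra.
  rewrite (_ : 1 - (1 - d) = d); last by ring.
  rewrite mulrAC ler_pdivlMr//.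
  apply: le_trans (_ : G * (1 / 2) <= _); first by lra.
  by rewrite mulrC ler_pM2r//; lra.
have [u /andP[u0 u2] uy] := lo; have [v /andP[v2 v1] yv] := hi.
have uv : u <= v by lra.
have cont : {within `[u, v], continuous (hyp_ratio a b)}.
  apply: continuous_in_subspaceT => x; rewrite inE/= in_itv/= => /andP[ux xv].
  by apply: hyp_ratio_continuous; rewrite (lt_le_trans u0)// (le_lt_trans xv).
have between : Num.min (hyp_ratio a b u) (hyp_ratio a b v) <= y <=
    Num.max (hyp_ratio a b u) (hyp_ratio a b v).
  by rewrite ge_min le_max uy yv orbT.
have [al] := IVT uv cont between; rewrite in_itv/= => /andP[ual alv] <-.
by exists al => //; rewrite (lt_le_trans u0)// (le_lt_trans alv).
Qed.

Lemma hyp_ratio_bij : set_bij `]0, 1[ `]0, +oo[ (hyp_ratio a b).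
Proof.
split.
- by move=> x; rewrite /= !in_itv/= andbT; exact: hyp_ratio_gt0.
- move=> x y; rewrite !inE/= !in_itv/= => /andP[x0 x1] /andP[y0 y1] xy.
  have [lt_xy|lt_yx|//] := ltgtP x y.
    by have := hyp_ratio_increasing x0 lt_xy y1; rewrite xy ltxx.
  by have := hyp_ratio_increasing y0 lt_yx x1; rewrite xy ltxx.
- move=> y; rewrite /= in_itv/= andbT => /hyp_ratio_surjective[al al01 <-].
  by exists al => //=; rewrite in_itv.
Qed.

Lemma PhiP (t : R) : 0 < t -> 0 < Phi a b t < 1 /\ hyp_ratio a b (Phi a b t) = t.
Proof.
move=> t_gt0; have [_ _ surj] := hyp_ratio_bij.
have t_img : (`]0, +oo[%classic : set R) t by rewrite /= in_itv/= t_gt0.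
split; last by apply: (surjpK (fun=> 0) surj); rewrite inE.
have : (`]0, 1[%classic : set R) (Phi a b t).
  by apply: (surjpinv_image_sub surj); exists t.
by rewrite /= in_itv.
Qed.

(** With p = t and gam_k = g(k/n), the drift t (n - k) - k g(k/n) vanishes at
    k = n th exactly when r(th) = t, and it pulls towards n th with strength at
    least t because k g(k/n) is nondecreasing in k. *)
Lemma log_deriv_concentration (n : nat) (t eps : R) :
  only_real_nonpos_roots (hyp_poly a b n) -> (0 < n)%N -> 0 < t -> 0 < eps ->
  `|t * list_mean (zeros n) (fun x => (t - x)^-1) - Phi a b t| <=
  eps + eps^-1 / n%:R.
Proof.
move=> real_n n_gt0 t_gt0 eps_gt0.
have n0 : n%:R != 0 :> R by rewrite pnatr_eq0 -lt0n.
have [/andP[th_gt0 th_lt1] th_eq] := PhiP t_gt0.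
set th := Phi a b t in th_gt0 th_lt1 th_eq *.
have [size_zs zs_lt0 PE] := hyp_poly_zeros a_range b_range real_n.
have [q_gt0 _] := hyp_weight_newton real_n.
pose c k : R := 'C(n, k)%:R * q n k * t ^+ k.
have c_gt0 k : (k <= n)%N -> 0 < c k.
  move=> kn; apply: mulr_gt0; last exact: exprn_gt0.
  by apply: mulr_gt0; [rewrite ltr0n bin_gt0|exact: q_gt0].
have sum_c : (hyp_poly a b n).[t] = \sum_(k < n.+1) c k.
  rewrite horner_coef size_hyp_poly; apply: eq_bigr => k _.
  by rewrite coef_hyp_poly.
have sum_kc : t * (hyp_poly a b n)^`().[t] = \sum_(k < n.+1) k%:R * c k.
  rewrite -[hyp_poly a b n]coefK poly_def size_hyp_poly raddf_sum horner_sum mulr_sumr.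
  apply: eq_bigr => -[[|k] kn] _ /=.
    by rewrite derivZ derivXn mul0r mulr0n scaler0 horner0 mulr0.
  rewrite derivZ derivXn hornerZ hornerMn hornerXn coef_hyp_poly /c -mulr_natl exprS.
  by ring.
have sum_c_gt0 : 0 < \sum_(k < n.+1) c k.
  rewrite big_ord_recl/= ltr_pwDl ?c_gt0// sumr_ge0// => k _.
  by rewrite ltW// c_gt0.
have meanE : t * list_mean (zeros n) (fun x => (t - x)^-1) - th =
    (\sum_(k < n.+1) (k%:R / n%:R - th) * c k) / \sum_(k < n.+1) c k.
  have t_zs : t \notin zeros n.
    by apply/negP => /zs_lt0 /(lt_trans t_gt0); rewrite ltxx.
  have := log_deriv_prod_XsubC t_zs; rewrite -PE sum_c => deriv_eq.
  under [in RHS]eq_bigr do rewrite mulrBl mulrAC.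
  rewrite sumrB -mulr_suml -mulr_sumr -sum_kc deriv_eq /list_mean size_zs.
  by field; rewrite gt_eqF.
have variance : \sum_(k < n.+1) (k%:R - n%:R * th) ^+ 2 * c k <=
    n%:R * \sum_(k < n.+1) c k.
  rewrite -(ler_pM2l t_gt0) mulrA.
  apply: (@balanced_weights_variance _ n c (fun k => g (k%:R / n%:R))).
  - exact: ltW.
  - by move=> k kn; exact/ltW/c_gt0.
  - move=> k kn; rewrite /c (hyp_weightS a b kn) exprS -natrB ?(ltnW kn)//.
    have := congr1 (fun m => m%:R : R) (mul_bin_left n k).
    rewrite /= !natrM => bin_rec.
    transitivity ((n - k)%:R * 'C(n, k)%:R *
      (q n k.+1 * g (k.+1%:R / n%:R) * t * t ^+ k)); first by ring.
    by rewrite -bin_rec; ring.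
  move=> k kn.
  have balance : t * (1 - th) = th * g th.
    rewrite -th_eq /hyp_ratio -/(g th).
    by field; rewrite subr_eq0 gt_eqF.
  have mono : 0 <= (k%:R * g (k%:R / n%:R) - n%:R * (th * g th)) * (k%:R - n%:R * th).
    have n_gt0' : 0 < n%:R :> R by rewrite ltr0n.
    have gth := shift_ratio_gt0 (_ : 0 < th <= 1).
    have {}gth : 0 < g th by apply: gth; rewrite th_gt0 ltW.
    case: k kn => [|k] kn.
      rewrite mul0r !sub0r mulrNN.
      exact: (mulr_ge0 (mulr_ge0 (ltW n_gt0') (mulr_ge0 (ltW th_gt0) (ltW gth)))
                       (mulr_ge0 (ltW n_gt0') (ltW th_gt0))).
    have y_gt0 : 0 < k.+1%:R / n%:R :> R by rewrite divr_gt0.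
    have y_le1 : k.+1%:R / n%:R <= 1 :> R by rewrite ler_pdivrMr// mul1r ler_nat.
    have [kth|thk] := leP (n%:R * th) k.+1%:R.
      have /andP[_ gg] : 0 < g th <= g (k.+1%:R / n%:R).
        by apply: shift_ratio_nondecreasing => //; rewrite ler_pdivlMr// mulrC.
      apply: mulr_ge0; last by rewrite subr_ge0.
      rewrite subr_ge0 mulrA.
      exact: (ler_pM (mulr_ge0 (ltW n_gt0') (ltW th_gt0)) (ltW gth) kth gg).
    have /andP[gy_gt0 gg] : 0 < g (k.+1%:R / n%:R) <= g th.
      apply: shift_ratio_nondecreasing => //; last exact: ltW.
      by rewrite ler_pdivrMr// mulrC ltW.
    rewrite -mulrNN !opprB; apply: mulr_ge0; last by rewrite subr_ge0 ltW.
    rewrite subr_ge0 mulrA.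
    exact: (ler_pM (ler0n R _) (ltW gy_gt0) (ltW thk) gg).
  rewrite -subr_ge0; apply: le_trans mono _; rewrite -balance.
  by rewrite le_eqVlt; apply/orP; left; apply/eqP; ring.
have := @weighted_sum_concentration _ n c (fun k => k%:R / n%:R - th) th eps eps^-1.
rewrite meanE normrM normfV [`|\sum_(k < n.+1) c k|]gtr0_norm// ler_pdivrMr//.
apply => //.
- by rewrite invr_ge0 ltW.
- by move=> k kn; exact/ltW/c_gt0.
move=> k _; set y := _ - th.
have [y_le|y_gt] := leP `|y| eps.
  by rewrite (le_trans y_le)// lerDl mulr_ge0 ?sqr_ge0// invr_ge0 ltW.
apply: (@le_trans _ _ (eps^-1 * y ^+ 2)); last by rewrite lerDr ltW.
by rewrite mulrC ler_pdivlMr// -real_normK ?num_real// expr2 ler_wpM2l// ltW.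
Qed.

Lemma zeros_stieltjes_cvg (t : R) : 0 < t ->
  list_mean (zeros n) (fun x => (t - x)^-1) @[n --> \oo] --> Phi a b t / t.
Proof.
move=> t_gt0; have t0 : t != 0 by rewrite gt_eqF.
suff : t * list_mean (zeros n) (fun x => (t - x)^-1) @[n --> \oo] --> Phi a b t.
  move=> lim; rewrite (_ : (fun n => _) =
      fun n => t * list_mean (zeros n) (fun x => (t - x)^-1) * t^-1).
    exact: cvgM lim (cvg_cst _).
  by apply/funext => n; rewrite mulrAC divff// mul1r.
apply/cvgrPdist_le => eps eps_gt0; near=> n.
have n_gt0 : 0 < n%:R :> R by rewrite ltr0n; near: n; exact: nbhs_infty_gt.
have eps2_gt0 : 0 < eps / 2 by rewrite divr_gt0.
rewrite distrC; apply: le_trans (log_deriv_concentration _ _ t_gt0 eps2_gt0) _.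
- by near: n.
- by rewrite -(ltr0n R).
suff : (eps / 2)^-1 / n%:R <= eps / 2 by lra.
rewrite ler_pdivrMr// -ler_pdivrMl//.
rewrite (le_trans (ltW (truncnS_gt _)))// ler_nat.
by near: n; exact: nbhs_infty_ge.
Unshelve. all: by end_near. Qed.

End zeros_hyp_poly.

(** * The limiting zero distribution *)

Lemma integral_empirical_zeros (R : realType) (n : nat) (P : {poly R})
    (f : \bar R -> R) :
  (forall w, w \in sphere_zeros n P -> (sphere_to_ereal w <= 0)%E) ->
  {within nonpos_ereal R, continuous f} ->
  (\int[empirical_zeros n P]_(z in nonpos_ereal R) (f z)%:E)%E =
  (n%:R^-1 * \sum_(w <- sphere_zeros n P) f (sphere_to_ereal w))%:E.
Proof.
move=> w_le0 cf; pose I (g : \bar R -> R) :=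
  n%:R^-1 * \sum_(w <- sphere_zeros n P) g (sphere_to_ereal w).
have mK := @measurable_nonpos_ereal R.
have [M fM] := bounded_within_nonpos cf.
apply: (@integral_by_sign _ _ _ _ _ I _ M) => //.
- exact: measurable_within_nonpos.
- move=> g mg g0 _; have mEg : measurable_fun (nonpos_ereal R) (fun z => (g z)%:E).
    exact/measurable_EFinP.
  rewrite /empirical_zeros ge0_integral_mscale//; last by move=> z _; rewrite lee_fin.
  rewrite ge0_integral_measure_sum//; last by move=> z _; rewrite lee_fin.
  rewrite /I EFinM /=; congr (_ * _)%E.
  rewrite (big_nth None) big_mkord -sumEFin; apply: eq_bigr => k _.
  rewrite integral_dirac// diracE mem_set ?mul1e//.
  by apply: w_le0; rewrite mem_nth.
- rewrite /I -mulrBr -sumrB; congr (_ * _); apply: eq_bigr => w _.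
  exact: max0_sub_maxN.
Qed.

Lemma continuous_unit_of_ereal (R : realType) : continuous (@unit_of_ereal R).
Proof.
move=> z; apply/cvgrPdist_lt => e e_gt0.
apply: filterS (nbhsx_ballx z e e_gt0) => w.
rewrite /ball/= /ereal_ball /unit_of_ereal; congr (`|_| < _); ring.
Qed.

(** At z = -oo the coordinate of z is 0, in accordance with the convention that
    the kernel vanishes there. *)
Lemma cauchy_kernelE (R : realType) (t : R) (z : \bar R) : 0 < t -> (z <= 0)%E ->
  cauchy_kernel t z = unit_of_ereal z / (1 + (t - 1) * unit_of_ereal z).
Proof.
move=> t_gt0; case: z => [r||] //=; last by rewrite /unit_of_ereal/= subrr mul0r.
rewrite lee_fin => r0; rewrite unit_of_erealE//.
by field; rewrite !gt_eqF//; lra.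
Qed.

Lemma continuous_cauchy_kernel (R : realType) (t : R) : 0 < t ->
  {within nonpos_ereal R, continuous (@cauchy_kernel R t)}.
Proof.
move=> t_gt0; pose k (u : R) := u / (1 + (t - 1) * u).
apply: (@subspace_eq_continuous _ _ _ (k \o @unit_of_ereal R)).
  by move=> z; rewrite inE => z0; exact/esym/cauchy_kernelE.
apply: continuous_in_subspaceT => z; rewrite inE => /unit_of_ereal_itv/andP[u0 u1].
apply: continuous_comp; first exact: continuous_unit_of_ereal.
apply: cvgM; first exact: cvg_id.
apply: cvgV; last first.
  by apply: cvgD; [exact: cvg_cst|apply: cvgM; [exact: cvg_cst|exact: cvg_id]].
rewrite gt_eqF// (_ : _ + _ = (1 - unit_of_ereal z) + t * unit_of_ereal z); last by ring.
have [u_lt1|] := ltP (unit_of_ereal z) 1.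
  by rewrite ltr_wpDr ?subr_gt0// mulr_ge0// ltW.
by move=> u_ge1; rewrite ltr_wpDl ?subr_ge0// mulr_gt0// (lt_le_trans ltr01).
Qed.

Unset Implicit Arguments.
Theorem theorem4p9 (R : realType) (i j : nat) (a : 'rV[R]_i) (b : 'rV[R]_j)
    (a_range : forall s : 'I_i, ~ (0 <= a ord0 s < 1))
    (b_range : forall s : 'I_j, ~ (0 <= b ord0 s < 1))
    (even_neg : ~~ odd (#|[set s : 'I_i | a ord0 s < 0]%SET| +
                        #|[set s : 'I_j | b ord0 s < 0]%SET|))
    (real_rooted : \forall n \near \oo, only_real_nonpos_roots (hyp_poly a b n)) :
  [/\ forall alpha : R, 0 < alpha < 1 -> 0 < hyp_ratio a b alpha,
      set_bij `]0, 1[ `]0, +oo[ (hyp_ratio a b) &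
      exists mu : probability (\bar R) R,
        [/\ mu (nonpos_ereal R) = 1%E,
            weakly_converges (fun n => empirical_zeros n (hyp_poly a b n)) mu &
            forall t : R, 0 < t ->
              cauchy_transform mu t = (Phi a b t / t)%:E]].
Proof.
split.
- by move=> alpha; exact: hyp_ratio_gt0.
- exact: hyp_ratio_bij.
pose zeros n := [seq complex.Re z | z <- complex_zeros (hyp_poly a b n)].
pose good n := `[< only_real_nonpos_roots (hyp_poly a b n) >] && (0 < n)%N.
have near_good : \forall n \near \oo, good n.
  near=> n; apply/andP; split; last by near: n; exact: nbhs_infty_gt.
  by apply/asboolP; near: n.
have goodP n : good n -> [/\ size (zeros n) = n, zeros n != [::] &
    {in zeros n, forall x, x < 0}].
  move=> /andP[/asboolP /(hyp_poly_zeros a_range b_range)[size_zs zs_lt0 _] n_gt0].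
  by rewrite -size_eq0 size_zs -lt0n.
(* The lists of zeros in the unit coordinate, with an arbitrary valid list at
   the finitely many degrees about which nothing is known. *)
pose s n := if good n then [seq unit_of_ereal x%:E | x <- zeros n] else [:: 0].
have s0 n : s n != [::].
  by rewrite /s; case: ifP => // /goodP[_ + _]; case: (zeros n).
have s01 n : {in s n, forall x, 0 <= x <= 1}.
  rewrite /s; case: ifP => [/goodP[_ _ zs_lt0]|_] x.
    by move=> /mapP[y /zs_lt0 y_lt0 ->]; rewrite unit_of_ereal_itv// lee_fin ltW.
  by rewrite inE => /eqP ->; rewrite lexx ler01.
have s_mean n (f : \bar R -> R) : good n ->
    list_mean (s n) (f \o @ereal_of_unit R) = list_mean (zeros n) (fun x => f x%:E).
  move=> good_n; rewrite /s good_n /list_mean size_map big_map.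
  by congr (_ / _); apply: eq_bigr => x _ /=; rewrite unit_of_erealK.
have kernel_cvg (t : R) : 0 < t ->
    list_mean (s n) (cauchy_kernel t \o @ereal_of_unit R) @[n --> \oo] -->
    Phi a b t / t.
  move=> t_gt0; have := zeros_stieltjes_cvg a_range b_range real_rooted t_gt0.
  apply: cvg_trans; apply: near_eq_cvg.
  by apply: filterS near_good => n /s_mean ->.
have stieltjes (t : R) : 0 <= t ->
    cvgn (fun n => list_mean (s n) (fun x => x / (1 + t * x))).
  move=> t0; have t1_gt0 : 0 < 1 + t by rewrite ltr_wpDr.
  apply/cvg_ex; exists (Phi a b (1 + t) / (1 + t)).
  have := kernel_cvg _ t1_gt0.
  rewrite (_ : (fun n => list_mean _ (fun x => _ / _)) =
    fun n => list_mean (s n) (cauchy_kernel (1 + t) \o @ereal_of_unit R)) //.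
  apply/funext => n; apply: eq_in_list_mean => x /s01 x01 /=.
  rewrite cauchy_kernelE ?ereal_of_unit_le0//; last by case/andP: x01.
  by rewrite ereal_of_unitK// [1 + t]addrC addrK.
have [mu [muK mu_cvg]] := helly_stieltjes s0 s01 stieltjes.
exists mu; split => // [f cf|t t_gt0].
  have := mu_cvg f cf; apply: cvg_trans; apply: near_eq_cvg.
  apply: filterS near_good => n good_n.
  have [size_zs _ zs_lt0] := goodP n good_n.
  have sphereE : sphere_zeros n (hyp_poly a b n) =
      map Some (complex_zeros (hyp_poly a b n)).
    by rewrite /sphere_zeros (size_hyp_poly a b) subnn cats0.
  rewrite s_mean// integral_empirical_zeros//.
    rewrite sphereE big_map /list_mean size_zs big_map.
    by rewrite mulrC.
  move=> w; rewrite sphereE => /mapP[z zZ ->]; rewrite /= lee_fin ltW// zs_lt0//.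
  exact: map_f.
have cK := continuous_cauchy_kernel t_gt0.
apply: (cvg_unique (@ereal_hausdorff R) (mu_cvg _ cK)).
by apply: cvg_EFin; [exact: nearW|exact: kernel_cvg].
Unshelve. all: by end_near. Qed.
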